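(* Let $X,X_1,X_2,\ldots$ be i.i.d. non-negative random variables with mean $\nu>0$ and with moment-generating function $\mathbb{E}[e^{\vartheta X}]$ finite for all $\vartheta$ in an open set containing $0$. Let $a>\nu$. For $\alpha>0$ put $$P_N(a):=\mathbb{P}\left(\mathrm{Pois}\left(N\,\overline{X}_{N^\alpha}\right)\geqslant Na\right),\qquad I(a\,|\,\nu):=a\log\frac{a}{\nu}-a+\nu,\qquad C(a\,|\,\nu):=\frac{1}{1-\nu/a}\,\frac{1}{\sqrt{2\pi a}},$$ where $N\to\infty$ through values for which $Na$ and $N^\alpha$ are integers. Then: (i) if $\alpha>3$, then, as $N\to\infty$, $$P_N(a)\sim e^{-N\,I(a\,|\,\nu)}\,\frac{C(a\,|\,\nu)}{\sqrt{N}};$$ (ii) if $\alpha\in(2,3]$, then $$\liminf_{N\to\infty}P_N(a)\,e^{N\,I(a\,|\,\nu)}\sqrt{N}\geqslant C(a\,|\,\nu).$$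
   Context: For a positive integer $m$, $\overline{X}_m:=\frac1m\sum_{i=1}^m X_i$. For a non-negative random variable $Y$, $\mathrm{Pois}(Y)$ denotes a mixed Poisson random variable: conditionally on $Y=y$ it has the Poisson distribution with mean $y$. The notation $f(N)\sim g(N)$ means $f(N)/g(N)\to1$ as $N\to\infty$. The limit in $N$ is taken along values for which $Na$ and $N^\alpha$ are positive integers. *)

(* Defs.v *)
From HB Require Import structures.
From mathcomp Require Export all_boot all_order all_algebra finmap.
From mathcomp Require Export all_classical all_reals all_analysis.

Set Implicit Arguments.
Unset Strict Implicit.
Unset Printing Implicit Defensive.

Import Order.TTheory GRing.Theory Num.Theory.
Import numFieldNormedType.Exports.

Local Open Scope classical_set_scope.
Local Open Scope ring_scope.

Definition mutually_independent (d : measure_display) (T : measurableType d)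
    (R : realType) (P : probability T R) (X : nat -> {RV P >-> R}) : Prop :=
  forall (J : {fset nat}) (B : nat -> set R),
    (forall i, measurable (B i)) ->
    (P (\bigcap_(i in [set` J]) (X i @^-1` B i)) =
       \prod_(i <- J) P (X i @^-1` B i))%E.

Definition identically_distributed (d : measure_display)
    (T : measurableType d) (R : realType) (P : probability T R)
    (X : nat -> {RV P >-> R}) : Prop :=
  forall (i j : nat) (B : set R), measurable B ->
    distribution P (X i) B = distribution P (X j) B.

Definition iid (d : measure_display) (T : measurableType d) (R : realType)
    (P : probability T R) (X : nat -> {RV P >-> R}) : Prop :=
  mutually_independent X /\ identically_distributed X.

(* The sum starts at 1: [X 0] is a generic copy, not part of the sample. *)
Definition sample_mean (T : Type) (R : realType) (X : nat -> T -> R)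
    (m : nat) (w : T) : R :=
  m%:R^-1 * \sum_(1 <= i < m.+1) X i w.

(* [poisson_prob] has a second argument that its definition ignores, set to 0
   here; its value at rate 0 is the Dirac mass at 0. *)
Definition poisson_law (R : realType) (y : R) : probability nat R :=
  poisson_prob y 0%N.

(* [Z] is a version of Pois(Y): y |-> poisson_law y is a regular conditional
   distribution of [Z] given [Y = y]. *)
Definition mixed_poisson (d : measure_display) (T : measurableType d)
    (R : realType) (P : probability T R) (Y : T -> R)
    (Z : {RV P >-> nat}) : Prop :=
  forall (B : set R) (A : set nat), measurable B ->
    (P ((Y @^-1` B) `&` (Z @^-1` A)) =
       \int[P]_(w in Y @^-1` B) poisson_law (Y w) A)%E.

(* [N] need not itself be an integer. *)
Definition admissible (R : realType) (a alpha : R) : set R :=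
  [set N | [/\ 0 < N, N * a \is a Num.nat & N `^ alpha \is a Num.nat]].

Definition admissible_infty (R : realType) (a alpha : R) : set_system R :=
  within (admissible a alpha) (pinfty_nbhs R).

Definition tail_prob (d : measure_display) (T : measurableType d)
    (R : realType) (P : probability T R) (Z : R -> {RV P >-> nat})
    (a N : R) : R :=
  fine (P [set w | N * a <= (Z N w)%:R]).

Definition rate_fun (R : realType) (a nu : R) : R := a * ln (a / nu) - a + nu.

Definition prefactor (R : realType) (a nu : R) : R :=
  (1 - nu / a)^-1 * (Num.sqrt (2 * pi * a))^-1.

Definition asymp_equiv (R : realType) (F : set_system R) (f g : R -> R) : Prop :=
  (fun N => f N / g N) @ F --> (1 : R).

(* Main.v *)
Require Import Defs.
From mathcomp Require Import measurable_realfun ring lra zify.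

Set Implicit Arguments.
Unset Strict Implicit.
Unset Printing Implicit Defensive.

Import Order.TTheory GRing.Theory Num.Theory.
Import numFieldNormedType.Exports.

Local Open Scope classical_set_scope.
Local Open Scope ring_scope.

(** The function h(y) = P(Pois(y) >= Na) is nondecreasing and P_N(a) is the
    expectation of h(N Xbar). By Chernoff's bound, N Xbar lies within a constant
    delta of N nu up to probability exp(- c N^(alpha - 2) delta^2). Hence P_N(a)
    is at least (1 - o(1)) h(N nu - delta) as soon as alpha > 2, while it is at
    most h(N nu + delta) plus an error which is o(exp(- N I) / sqrt N) only if
    alpha > 3. Comparing the Poisson tail with geometric series from above and
    below and applying Stirling's formula to its first term gives the asymptotics
    of h(N nu +- delta), with a factor tending to 1 as delta tends to 0. *)

(** The shift must have constant size: near N nu the logarithmic derivative of [h] is about a / nu -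
    1, so moving the rate by [dlt] costs the bounded factor exp(+- dlt (a / nu - 1)), whereas a
    shift growing with [N] would destroy the prefactor. For the mean of N^alpha variables this is a
    deviation [dlt / N], hence the exponent N^alpha (dlt / N)^2. In the lower bound the exceptional
    event only has to become improbable, so divergence of this exponent suffices; in the upper bound
    its probability is added to a quantity of order exp(- N I) / sqrt N, so the exponent must
    outgrow N I, and this is where 3 enters. After multiplication by exp(N I) sqrt N every estimate
    is a non-asymptotic inequality, Stirling's error being stored in [stirling_rem]. Limits are then
    taken along all real [N], with [Num.truncn (N * a)] as the integer threshold, and restricted to
    admissible [N] afterwards. *)

Section Stirling.
Context {R : realType}.

Lemma le_is_derive (f df : R -> R) (x y : R) : x <= y ->
    (forall t, x <= t <= y -> is_derive t 1 f (df t)) ->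
    (forall t, x <= t <= y -> 0 <= df t) -> f x <= f y.
Proof.
move=> xy fdf df0.
have [|| c] := @MVT_segment R f df x y xy.
- move=> t; rewrite in_itv/= => /andP[xt ty]; apply: fdf.
  by rewrite (ltW xt) (ltW ty).
- apply: derivable_within_continuous => t; rewrite in_itv/= => xty.
  by apply: ex_derive; exact: fdf.
rewrite in_itv/= => /df0 dfc0 fxy.
by rewrite -subr_ge0 fxy mulr_ge0// subr_ge0.
Qed.

(* Antiderivatives of [sin ^ n], by the reduction formula: they give access to
   the Wallis integrals without any integration. *)
Fixpoint sinX_prim (n : nat) : R -> R :=
  match n with
  | 0 => id
  | 1 => fun x => - cos x
  | m.+2 => fun x =>
      m.+2%:R^-1 * (m.+1%:R * sinX_prim m x - sin x ^+ m.+1 * cos x)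
  end.

Lemma is_derive_sinX_prim n (x : R) :
  is_derive x 1 (sinX_prim n) (sin x ^+ n).
Proof.
elim/ltn_ind: n x => -[|[|n]] ih x.
- by rewrite expr0; exact: is_derive_id.
- by rewrite expr1 -[sin x]opprK; exact: is_deriveN.
have ihn := ih n (ltnW (ltnSn _)) x.
pose f : R -> R :=
  n.+2%:R^-1 *: (n.+1%:R *: sinX_prim n - (sin : R -> R) ^+ n.+1 * (cos : R -> R)).
have -> : sinX_prim n.+2 = f.
  by apply/funext => t; rewrite /f /= !fctE.
rewrite /f; apply: is_derive_eq.
rewrite /GRing.scale/= ?fctE.
have n2 : n.+2%:R != 0 :> R by rewrite pnatr_eq0.
rewrite !exprS mulrN.
rewrite -!natr1; rewrite -!natr1 in n2.
transitivity ((n%:R + 1 + 1)^-1 * (sin x ^+ n *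
  ((n%:R + 1) * (1 - cos x ^+ 2) + sin x ^+ 2))); first by ring.
by rewrite cos2sin2; field.
Qed.

(** * Wallis integrals and the central binomial coefficient *)

Definition wallis n : R := sinX_prim n (pi / 2) - sinX_prim n 0.

Lemma wallisSS n : wallis n.+2 = n.+1%:R / n.+2%:R * wallis n.
Proof.
by rewrite /wallis /= cos_pihalf sin0 expr0n/=; ring.
Qed.

Lemma wallis0 : wallis 0 = pi / 2.
Proof. by rewrite /wallis/= subr0. Qed.

Lemma wallis1 : wallis 1 = 1.
Proof. by rewrite /wallis/= cos_pihalf cos0; ring. Qed.

Lemma wallis_decr n : wallis n.+1 <= wallis n.
Proof.
have p0 : 0 <= pi / 2 :> R by rewrite divr_ge0 ?pi_ge0.
pose F : R -> R := sinX_prim n - sinX_prim n.+1.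
have : F 0 <= F (pi / 2).
  apply: (@le_is_derive F (fun x => sin x ^+ n - sin x ^+ n.+1) _ _ p0) => t tp.
  - by apply: is_deriveB; exact: is_derive_sinX_prim.
  - have s0 : 0 <= sin t.
      apply: sin_ge0_pi; move/andP: tp => [-> /le_trans->//].
      by have := pi_ge0 R; lra.
    rewrite exprS -[X in X - _]mul1r -mulrBl mulr_ge0 ?exprn_ge0// subr_ge0; exact: sin_le1.
  by rewrite /F /wallis !fctE; lra.
Qed.

(** This is 4^n divided by the central binomial coefficient of 2n; the Wallis integrals of even and
    of odd index are both expressed through it. *)
Definition cbinom_inv n : R := 4 ^+ n * n`!%:R ^+ 2 / (n.*2)`!%:R.

Lemma cbinom_inv_gt0 n : 0 < cbinom_inv n.
Proof. by rewrite /cbinom_inv divr_gt0 ?mulr_gt0 ?exprn_gt0 ?ltr0n ?fact_gt0. Qed.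

Lemma cbinom_invS n : cbinom_inv n.+1 = (n.*2.+2%:R / n.*2.+1%:R) * cbinom_inv n.
Proof.
rewrite /cbinom_inv doubleS !factS !natrM exprS.
have f0 : (n.*2)`!%:R != 0 :> R by rewrite pnatr_eq0 -lt0n fact_gt0.
have -> : (n.*2.+2%:R : R) = 2 * n.+1%:R by rewrite -doubleS -mul2n natrM.
by field; rewrite f0 !nat1r !pnatr_eq0.
Qed.

Lemma wallis_even n : wallis n.*2 = pi / (2 * cbinom_inv n).
Proof.
elim: n => [|n ih].
  by rewrite wallis0 /cbinom_inv !fact0 expr0 expr1n mul1r divr1 mulr1.
rewrite doubleS wallisSS ih cbinom_invS.
have := cbinom_inv_gt0 n; move=> /lt0r_neq0 c0.
by field; rewrite c0 ?nat1r ?natr1 -?natrD ?pnatr_eq0.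
Qed.

Lemma wallis_odd n : wallis n.*2.+1 = cbinom_inv n / n.*2.+1%:R.
Proof.
elim: n => [|n ih].
  by rewrite wallis1 /cbinom_inv !fact0 expr0 expr1n mul1r !divr1.
rewrite doubleS wallisSS ih cbinom_invS.
by field; rewrite ?nat1r -?natrD ?pnatr_eq0.
Qed.

(** Monotonicity of [wallis] at two consecutive places: from index 2n to 2n + 1 it gives the upper
    bound, from 2n - 1 to 2n the lower one, which is trivial for n = 0. *)
Lemma wallis_bounds n :
  n%:R * pi <= cbinom_inv n ^+ 2 <= (n%:R + 2^-1) * pi.
Proof.
have c0 := cbinom_inv_gt0 n; have c0' := lt0r_neq0 c0.
have p0 := pi_gt0 R.
apply/andP; split; last first.
  have := wallis_decr n.*2; rewrite wallis_odd wallis_even.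
  rewrite ler_pdivlMr ?mulr_gt0// => h.
  have -> : (n%:R + 2^-1 = n.*2.+1%:R / 2 :> R).
    by rewrite -[n.*2.+1]addn1 natrD -mul2n natrM; field.
  move: h; rewrite (_ : cbinom_inv n / _ * _ = 2 * cbinom_inv n ^+ 2 / n.*2.+1%:R); last first.
    by field; rewrite ?nat1r -?natrD ?pnatr_eq0.
  by rewrite ler_pdivrMr ?ltr0n//; lra.
case: n => [|n] in c0 c0' *; first by rewrite mul0r sqr_ge0.
have := wallis_decr n.*2.+1; rewrite -doubleS wallis_even wallis_odd.
rewrite ler_pdivrMr ?mulr_gt0//.
have -> : cbinom_inv n / n.*2.+1%:R = cbinom_inv n.+1 / n.*2.+2%:R.
  by rewrite cbinom_invS; field; rewrite ?nat1r -?natrD ?pnatr_eq0.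
have -> : (n.*2.+2%:R : R) = 2 * n.+1%:R by rewrite -doubleS -mul2n natrM.
rewrite (_ : _ / _ * _ = cbinom_inv n.+1 ^+ 2 / n.+1%:R); last first.
  by field; rewrite ?nat1r -?natrD ?pnatr_eq0.
by rewrite ler_pdivlMr ?ltr0n// mulrC.
Qed.

(** * Logarithm bounds and the constant in Stirling's formula *)

Lemma ln1D_ge (t : R) : 0 <= t -> 2 * t / (2 + t) <= ln (1 + t).
Proof.
move=> t0.
pose f : R -> R := (@ln R \o (cst 1 + id)) -
  (cst 2 - 4 *: (fun u => ((cst 2 + id : R -> R) u)^-1)).
have : f 0 <= f t.
  apply: (@le_is_derive f (fun t => (1 + t)^-1 - 4 / (2 + t) ^+ 2) _ _ t0) =>
    u /andP[u0 _].
    have u1 : 0 < (cst 1 + id : R -> R) u by rewrite !fctE/=; lra.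
    have u2 : (cst 2 + id : R -> R) u != 0.
      by rewrite !fctE/=; apply: lt0r_neq0; lra.
    have dl := is_derive1_ln u1.
    have dv := is_deriveV u2
      (is_deriveD (is_derive_cst _ _ _) (is_derive_id u (1 : R))).
    rewrite /f; apply: is_derive_eq.
    rewrite /GRing.scale/= ?fctE; rewrite !fctE /= in u1 u2.
    by field; rewrite u2 lt0r_neq0.
  have u1 : 1 + u != 0 by apply: lt0r_neq0; lra.
  have u2 : 2 + u != 0 by apply: lt0r_neq0; lra.
  rewrite (_ : _ - _ = u ^+ 2 / ((1 + u) * (2 + u) ^+ 2)); last first.
    by field; rewrite u1 u2.
  by rewrite divr_ge0 ?sqr_ge0// mulr_ge0 ?sqr_ge0//; lra.
rewrite /f !fctE/= /GRing.scale/= !addr0 ln1.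
rewrite (_ : 2 * t / (2 + t) = 2 - 4 * (2 + t)^-1); last first.
  by field; apply: lt0r_neq0; lra.
lra.
Qed.

Lemma ln1D_le (t : R) : 0 <= t -> ln (1 + t) <= ((1 + t) - (1 + t)^-1) / 2.
Proof.
move=> t0.
pose f : R -> R := 2^-1 *: ((cst 1 + id) -
  (fun u => ((cst 1 + id : R -> R) u)^-1)) - (@ln R \o (cst 1 + id)).
have : f 0 <= f t.
  apply: (@le_is_derive f (fun t => (1 - (1 + t)^-1) ^+ 2 / 2) _ _ t0) => u /andP[u0 _].
    have u1 : 0 < (cst 1 + id : R -> R) u by rewrite !fctE/=; lra.
    have dl := is_derive1_ln u1.
    have dv := is_deriveV (lt0r_neq0 u1)
      (is_deriveD (is_derive_cst _ _ _) (is_derive_id u (1 : R))).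
    rewrite /f; apply: is_derive_eq.
    rewrite /GRing.scale/= ?fctE; rewrite !fctE /= in u1.
    by field; rewrite lt0r_neq0.
  by rewrite divr_ge0 ?sqr_ge0.
rewrite /f !fctE /= /GRing.scale /= !addr0 ln1 invr1; lra.
Qed.

(** The two bounds on [ln (1 + t)] at t = 1 / (n + 1). Multiplied by n + 3/2, the lower one is
    exactly 1 and the upper one exceeds 1 by a telescoping difference; the middle term is the
    decrement of [stirling_rem]. *)
Lemma lnS_bounds n : (0 : R) <= (n.+1%:R + 2^-1) * (ln n.+2%:R - ln (n.+1%:R : R)) - 1 <=
  (4 * n.+1%:R)^-1 - (4 * n.+2%:R)^-1 .
Proof.
have n1 : 0 < n.+1%:R :> R by rewrite ltr0n.
have n2 : 0 < n.+2%:R :> R by rewrite ltr0n.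
have t0 : 0 <= n.+1%:R^-1 :> R by rewrite invr_ge0 ltW.
rewrite -ln_div ?posrE//.
have -> : n.+2%:R / n.+1%:R = 1 + n.+1%:R^-1 :> R.
  by rewrite -[n.+2]addn1 natrD mulrDl mul1r divff// lt0r_neq0.
have h1 := ln1D_ge t0; have h2 := ln1D_le t0.
have c0 : 0 <= n.+1%:R + 2^-1 :> R by lra.
apply/andP; split.
  have := ler_wpM2l c0 h1.
  rewrite (_ : _ * (2 * _ / _) = 1); first by lra.
  field; rewrite -?natrD ?nat1r -?natrM -?natrD ?pnatr_eq0/=.
  by rewrite natr1 pnatr_eq0.
have {h2} := ler_wpM2l c0 h2.
rewrite [X in _ <= X -> _](_ : _ = 1 + ((4 * n.+1%:R)^-1 - (4 * n.+2%:R)^-1)).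
  by move=> h; rewrite lerBlDl.
have n0 : 0 <= n%:R :> R by [].
rewrite -[n.+2]addn1 natrD.
by field; rewrite !lt0r_neq0//; lra.
Qed.

(* [n! = exp (stirling_rem n) * (n / e) ^ n * sqrt n] for [n > 0]. *)
Definition stirling_rem n : R :=
  ln n`!%:R + n%:R - (n%:R + 2^-1) * ln n%:R.

Lemma stirling_remS n : stirling_rem n.+1 - stirling_rem n.+2 =
  (n.+1%:R + 2^-1) * (ln n.+2%:R - ln n.+1%:R) - 1.
Proof.
rewrite /stirling_rem (factS n.+1) natrM lnM ?posrE ?ltr0n ?fact_gt0//.
by ring.
Qed.

Lemma nonincreasing_stirling_rem :
  nonincreasing_seq (fun n => stirling_rem n.+1).
Proof.
apply/nonincreasing_seqP => n; rewrite -subr_ge0 stirling_remS.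
by case/andP: (lnS_bounds n).
Qed.

(** The telescoping bound on the decrements makes [stirling_rem m - (4 * m)^-1] nondecreasing in m
    >= 1, and its value at m = 1 is 1 - 1/4. *)
Lemma stirling_rem_ge n : 3 / 4 + (4 * n.+1%:R)^-1 <= stirling_rem n.+1.
Proof.
elim: n => [|n ih].
  by rewrite /stirling_rem ?ln1; lra.
have /andP[_] := lnS_bounds n; rewrite -stirling_remS; move: ih.
move: (4 * n.+1%:R)^-1 (4 * n.+2%:R)^-1 (stirling_rem n.+1) (stirling_rem n.+2).
by move=> A B C D; lra.
Qed.

Lemma is_cvg_stirling_rem : cvgn (fun n => stirling_rem n.+1).
Proof.
apply: nonincreasing_is_cvgn; first exact: nonincreasing_stirling_rem.
exists 0 => _ [n _ <-]; apply: le_trans (stirling_rem_ge n).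
by rewrite addr_ge0// ?invr_ge0 ?mulr_ge0//; lra.
Qed.

(** In this combination the linear terms and n ln n cancel; what remains is the central binomial
    coefficient, which Wallis controls. *)
Lemma stirling_rem_double n : (0 < n)%N ->
  2 * stirling_rem n - stirling_rem n.*2 =
  ln (cbinom_inv n) + (ln 2 - ln n%:R) / 2.
Proof.
move=> n0.
rewrite /stirling_rem /cbinom_inv.
have f1 : 0 < n`!%:R :> R by rewrite ltr0n fact_gt0.
have f2 : 0 < (n.*2)`!%:R :> R by rewrite ltr0n fact_gt0.
have n1 : 0 < n%:R :> R by rewrite ltr0n.
rewrite ln_div ?lnM ?lnXn ?posrE ?mulr_gt0 ?exprn_gt0//.
rewrite -mul2n natrM lnM ?posrE//.
have -> : (4 : R) = 2 ^+ 2 by rewrite expr2; lra.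
rewrite lnXn//.
by field.
Qed.

(** The limit [l] exists by monotonicity, and the doubled combination tends to 2 l - l = l. Wallis
    evaluates that same limit, which identifies [l]. *)
Lemma cvg_stirling_rem : stirling_rem n @[n --> \oo] --> ln (2 * pi) / 2.
Proof.
set l := limn (fun n => stirling_rem n.+1).
have cl : stirling_rem n @[n --> \oo] --> l.
  by rewrite -(cvg_shiftS stirling_rem); exact: is_cvg_stirling_rem.
have cl2 : 2 * stirling_rem n - stirling_rem n.*2 @[n --> \oo] --> 2 * l - l.
  apply: cvgB; first by apply: cvgMr; exact: cl.
  apply: (cvg_comp double _ _ cl).
  by rewrite (_ : double = muln 2); [exact: cvg_mulnl|apply/funext => n; rewrite mul2n].
suff cw : 2 * stirling_rem n - stirling_rem n.*2 @[n --> \oo] --> ln (2 * pi) / 2.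
  have := cvg_unique (@Rhausdorff R) cl2 cw.
  by rewrite mulr_natl mulr2n addrK => <-.
have p0 := pi_gt0 R.
apply: (@squeeze_cvgr _ _ _ _ (fun=> ln (2 * pi) / 2)
  (fun n => ln (2 * pi) / 2 + n%:R^-1)).
- near=> n.
  have n0 : (0 < n)%N by near: n; exact: nbhs_infty_gt.
  have n0' : 0 < n%:R :> R by rewrite ltr0n.
  have hn : 0 < n%:R + 2^-1 :> R by rewrite addr_gt0.
  have i0 : 0 < n%:R^-1 :> R by rewrite invr_gt0.
  have i1 : 0 < 2^-1 / n%:R :> R by rewrite mulr_gt0.
  have h3 : ln (1 + 2^-1 / n%:R) <= 2^-1 / n%:R :> R.
    by apply: le_ln1Dx; rewrite (lt_trans _ i1)//; lra.
  rewrite stirling_rem_double//.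
  have := wallis_bounds n; have := cbinom_inv_gt0 n.
  move: (cbinom_inv n) => c c0 /andP[].
  rewrite -ler_ln ?posrE ?mulr_gt0 ?exprn_gt0// lnXn// lnM ?posrE// => h1.
  rewrite -ler_ln ?posrE ?mulr_gt0 ?exprn_gt0//.
  rewrite (_ : n%:R + 2^-1 = n%:R * (1 + 2^-1 / n%:R)); last first.
    by field; rewrite lt0r_neq0.
  have i3 : 0 < 1 + 2^-1 / n%:R :> R by rewrite addr_gt0.
  rewrite lnXn// !lnM ?posrE ?mulr_gt0// => h2.
  move: h1 h2 h3 i0; clear.
  move: (ln c) (ln (1 + _)) (n%:R^-1) => A B C h1 h2 h3 C0.
  by apply/andP; split; lra.
- exact: cvg_cst.
- rewrite -[X in _ --> X]addr0; apply: cvgD; first exact: cvg_cst.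
  apply/gtr0_cvgV0; last exact: cvgr_idn.
  by near=> n; rewrite ltr0n; near: n; exact: nbhs_infty_gt.
Unshelve. all: by end_near. Qed.
End Stirling.

(** * Poisson tails at a fixed rate *)

Section PoissonTail.
Context {R : realType}.
Implicit Types (k n j : nat) (y : R).

Definition poisson_tail y k : \bar R := poisson_law y [set n | (k <= n)%N].

Definition poisson_mass y k : R := expR (- y) * (y ^+ k / k`!%:R).

Lemma poisson_mass_ge0 y k : 0 <= y -> 0 <= poisson_mass y k.
Proof. by move=> y0; rewrite mulr_ge0 ?expR_ge0// divr_ge0 ?exprn_ge0. Qed.

Lemma poisson_pmfE y k : 0 < y -> poisson_pmf y k = poisson_mass y k.
Proof. by move=> y0; rewrite /poisson_pmf y0 mulrC. Qed.

Lemma poisson_tailE y k : 0 < y ->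
  poisson_tail y k = (\sum_(k <= i <oo) (poisson_mass y i)%:E)%E.
Proof.
move=> y0; rewrite /poisson_tail /poisson_law/= /poisson_prob y0.
rewrite eseries_cond nneseries_esum; last first.
  by move=> n _; rewrite lee_fin poisson_mass_ge0// ltW.
by apply: eq_esum => i _; rewrite poisson_pmfE.
Qed.

Lemma poisson_tailDE y k : 0 < y ->
  poisson_tail y k = (\sum_(i <oo) (poisson_mass y (i + k))%:E)%E.
Proof.
move=> y0; rewrite poisson_tailE//.
symmetry; apply: (@nneseries_addn R (fun i => (poisson_mass y i)%:E)).
by move=> i; rewrite lee_fin poisson_mass_ge0// ltW.
Qed.

(** The complement of the tail is a finite sum, so differentiability and measurability in the rate
    are read off from it rather than from a series. *)
Definition poisson_head k y : R := \sum_(j < k) poisson_mass y j.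

Lemma poisson_tail_head y k : 0 <= y ->
  poisson_tail y k = (1 - poisson_head k y)%:E.
Proof.
rewrite le_eqVlt => /predU1P[<-|y0].
  (* Rate 0: the law is the Dirac mass at 0, and the head reduces to its term j = 0, equal to 1
     since [0 ^+ 0 = 1], unless k = 0 and it is empty. *)
  rewrite /poisson_tail /poisson_law/= /poisson_prob ltxx diracE.
  case: k => [|k]; first by rewrite mem_set// /poisson_head big_ord0 subr0.
  rewrite memNset// /poisson_head big_ord_recl big1 ?addr0.
    by rewrite /poisson_mass oppr0 expR0 expr0 fact0 divr1 mulr1 subrr.
  by move=> i _; rewrite /poisson_mass exprS mul0r mul0r mulr0.
have : poisson_tail y 0 = 1%E.
  rewrite /poisson_tail (_ : [set n | (0 <= n)%N] = setT)//; last by apply/seteqP.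
  by rewrite probability_setT.
rewrite poisson_tailE// (nneseries_split _ k); last first.
  by move=> n _; rewrite lee_fin poisson_mass_ge0// ltW.
rewrite add0n -poisson_tailE// sumEFin big_mkord -/(poisson_head k y) => h.
by rewrite EFinB -h addeAC subee ?add0e.
Qed.

Lemma is_derive_poisson_mass0 y :
  is_derive y 1 (poisson_mass ^~ 0%N) (- poisson_mass y 0).
Proof.
have -> : (poisson_mass ^~ 0%N) = (fun x => expR (- x)).
  by apply/funext => x; rewrite /poisson_mass expr0 fact0 divr1 mulr1.
rewrite /poisson_mass expr0 fact0 divr1 mulr1 -mulrN1.
exact: (@is_derive1_comp R expR (fun x => - x)).
Qed.

Lemma is_derive_poisson_massS k y : is_derive y 1 (poisson_mass ^~ k.+1)
  (poisson_mass y k - poisson_mass y k.+1).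
Proof.
have de : is_derive y 1 (fun x : R => expR (- x)) (expR (- y) * -1).
  exact: (@is_derive1_comp R expR (fun x => - x)).
have dx : is_derive y 1 ((id : R -> R) ^+ k.+1) _ := is_deriveX k.+1 (is_derive_id _ _).
have -> : (poisson_mass ^~ k.+1) =
    (fun x : R => expR (- x)) * (k.+1`!%:R^-1 *: (id : R -> R) ^+ k.+1).
  by apply/funext => x; rewrite /poisson_mass !fctE [_ / _]mulrC.
apply: is_derive_eq.
rewrite /poisson_mass /GRing.scale/= !fctE /GRing.scale/=.
have f0 : k`!%:R != 0 :> R by rewrite pnatr_eq0 -lt0n fact_gt0.
by rewrite factS natrM; field; rewrite f0 nat1r pnatr_eq0.
Qed.

(** Each mass has as derivative the preceding mass minus itself, so the sum telescopes. The tail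
    therefore has the derivative [poisson_mass y k >= 0], which gives monotonicity in the rate. *)
Lemma is_derive_poisson_head k y :
  is_derive y 1 (poisson_head k.+1) (- poisson_mass y k).
Proof.
elim: k => [|k ih].
  rewrite (_ : poisson_head 1 = poisson_mass ^~ 0%N); last first.
    by apply/funext => x; rewrite /poisson_head big_ord_recl big_ord0 addr0.
  exact: is_derive_poisson_mass0.
rewrite (_ : poisson_head k.+2 = poisson_head k.+1 + poisson_mass ^~ k.+1); last first.
  by apply/funext => x; rewrite /poisson_head big_ord_recr.
have dm := is_derive_poisson_massS k y.
by apply: is_derive_eq; ring.
Qed.

Lemma poisson_tail_le y y' k : 0 <= y -> y <= y' ->
  (poisson_tail y k <= poisson_tail y' k)%E.
Proof.
move=> y0 yy'; rewrite !poisson_tail_head ?(le_trans y0)// lee_fin lerD2l lerN2.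
case: k => [|k]; first by rewrite /poisson_head !big_ord0.
rewrite -lerN2.
apply: (@le_is_derive R (- poisson_head k.+1) (fun x => poisson_mass x k) _ _ yy').
  move=> t _; rewrite -[poisson_mass t k]opprK.
  by apply: is_deriveN; exact: is_derive_poisson_head.
by move=> t /andP[yt _]; rewrite poisson_mass_ge0// (le_trans y0).
Qed.

Lemma poisson_massS y k : poisson_mass y k.+1 = y / k.+1%:R * poisson_mass y k.
Proof.
have f0 : k`!%:R != 0 :> R by rewrite pnatr_eq0 -lt0n fact_gt0.
rewrite /poisson_mass factS natrM exprS.
by field; rewrite f0 nat1r pnatr_eq0.
Qed.

Lemma poisson_mass_le y k i : 0 <= y -> (0 < k)%N ->
  poisson_mass y (i + k) <= (y / k%:R) ^+ i * poisson_mass y k.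
Proof.
move=> y0 k0; elim: i => [|i ih]; first by rewrite expr0 mul1r.
rewrite addSn poisson_massS exprS -[leRHS]mulrA ler_pM ?divr_ge0 ?poisson_mass_ge0//.
by rewrite ler_wpM2l// lef_pV2 ?posrE ?ltr0n// ler_nat; lia.
Qed.

(** Ratios of successive masses decrease to 0, so a geometric lower bound can hold only on a window
    of [J] terms. With [J] fixed and [k], [y] of order [N], its ratio has the same limit as the
    ratio [y / k] of the upper bound. *)
Lemma poisson_mass_ge y k i J : 0 <= y -> (i <= J)%N ->
  (y / (k + J)%:R) ^+ i * poisson_mass y k <= poisson_mass y (i + k).
Proof.
move=> y0; elim: i => [|i ih] iJ; first by rewrite expr0 mul1r.
rewrite addSn poisson_massS exprS -[leLHS]mulrA ler_pM ?divr_ge0//.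
- by rewrite mulr_ge0 ?poisson_mass_ge0// exprn_ge0// divr_ge0.
- by rewrite ler_wpM2l// lef_pV2 ?posrE ?ltr0n// ?ler_nat; lia.
- by apply: ih; exact: ltnW.
Qed.

Lemma poisson_tail_ub y k : 0 < y -> y < k%:R ->
  (poisson_tail y k <= ((1 - y / k%:R)^-1 * poisson_mass y k)%:E)%E.
Proof.
move=> y0 yk.
have k0 : 0 < k%:R :> R := lt_trans y0 yk.
have q0 : 0 <= y / k%:R by rewrite divr_ge0// ltW.
have q1 : y / k%:R < 1 by rewrite ltr_pdivrMr// mul1r.
rewrite poisson_tailDE//; apply: lime_le.
  by apply: is_cvg_nneseries => n _ _; rewrite lee_fin poisson_mass_ge0// ltW.
apply: nearW => n; rewrite sumEFin lee_fin.
apply: (@le_trans _ _ (\sum_(0 <= i < n) (y / k%:R) ^+ i * poisson_mass y k)).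
  apply: ler_sum => i _; apply: poisson_mass_le; first exact: ltW.
  by rewrite -(ltr0n R).
rewrite -mulr_suml ler_wpM2r ?poisson_mass_ge0 ?(ltW y0)//.
rewrite -[leRHS]mul1r ler_pdivlMr ?subr_gt0//.
rewrite big_mkord; have := subrX1 (y / k%:R) n; have := exprn_ge0 n q0.
by move: q0 q1; move: (y / k%:R) => q q0 q1 p0 ps; lra.
Qed.

Lemma poisson_tail_lb y k J : 0 < y ->
  (((\sum_(i < J) (y / (k + J)%:R) ^+ i) * poisson_mass y k)%:E <=
   poisson_tail y k)%E.
Proof.
move=> y0; rewrite poisson_tailDE//.
apply: le_trans (nneseries_lim_ge J _); last first.
  by move=> n _ _; rewrite lee_fin poisson_mass_ge0// ltW.
rewrite sumEFin lee_fin big_mkord mulr_suml ler_sum// => i _.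
by apply: poisson_mass_ge; [exact: ltW|exact: ltnW].
Qed.

Lemma expR_half_ln (x : R) : 0 < x -> expR (ln x / 2) = Num.sqrt x.
Proof. by move=> x0; rewrite -powR12_sqrt ?ltW// /powR gt_eqF// mulrC. Qed.

(** An identity, not an approximation: the error of Stirling's formula stays in [stirling_rem k]
    until the final limit. *)
Lemma poisson_mass_stirling y k : 0 < y -> (0 < k)%N ->
  poisson_mass y k =
  expR (k%:R - y + k%:R * ln (y / k%:R) - stirling_rem k) / Num.sqrt k%:R.
Proof.
move=> y0 k0; have k0' : 0 < k%:R :> R by rewrite ltr0n.
have f0 : 0 < k`!%:R :> R by rewrite ltr0n fact_gt0.
rewrite -(expR_half_ln k0') -expRB /poisson_mass.
have -> : y ^+ k / k`!%:R = expR (ln (y ^+ k / k`!%:R)).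
  by rewrite lnK// posrE divr_gt0// exprn_gt0.
rewrite -expRD !ln_div ?posrE ?exprn_gt0// lnXn// /stirling_rem.
congr expR; move: (ln k%:R) (ln k`!%:R) (ln y) => a b c.
by field.
Qed.
End PoissonTail.

(** * Expectations of products of independent variables *)

Section Independence.
Context (d : measure_display) (T : measurableType d) (R : realType).

Import HBNNSimple.

(** The hypothesis on [g] is the case of an indicator [f]. Linearity extends it to simple functions,
    decomposed over their level sets, and monotone convergence to all non-negative measurable [f].
    Since only events of [X] are tested, [g] may be built from any number of other variables. *)
Lemma ge0_integralM_indep (d' : measure_display) (T' : measurableType d')
    (mu : {measure set T -> \bar R}) (X : T -> T') (g : T -> R) (c : R)
    (f : T' -> \bar R) :
    measurable_fun setT X -> measurable_fun setT g -> (forall w, 0 <= g w) ->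
    0 <= c ->
    (forall B, measurable B ->
       \int[mu]_(w in X @^-1` B) (g w)%:E = c%:E * mu (X @^-1` B))%E ->
    measurable_fun setT f -> (forall y, 0 <= f y)%E ->
  (\int[mu]_w (f (X w) * (g w)%:E) = c%:E * \int[mu]_w f (X w))%E.
Proof.
move=> mX mg g0 c0 Xg mf f0.
have mg' : measurable_fun setT (EFin \o g) by exact/measurable_EFinP.
pose h := nnsfun_approx measurableT mf.
have mhX n : measurable_fun setT (EFin \o h n \o X).
  by apply: measurableT_comp mX; exact/measurable_EFinP.
have mfX : measurable_fun setT (f \o X) by exact: measurableT_comp mX.
have hf y : (h n y)%:E @[n --> \oo] --> f y.
  exact: (cvg_nnsfun_approx measurableT mf).
have ndh y : {homo (fun n => h n y) : m n / (m <= n)%N >-> m <= n}.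
  by move=> m n mn; exact/lefP/nd_nnsfun_approx.
rewrite -ge0_integralZl_EFin//.
transitivity (limn (fun n => \int[mu]_w ((h n (X w))%:E * (g w)%:E)))%E.
  rewrite -monotone_convergence//.
  - apply: eq_integral => w _; apply/esym/cvg_lim => //.
    by apply: cvgeZr.
  - by move=> n; exact: emeasurable_funM (mhX n) mg'.
  - by move=> n w _; rewrite mule_ge0// lee_fin.
  - by move=> w _ m n mn; rewrite lee_wpmul2r ?lee_fin ?ndh.
transitivity (limn (fun n => \int[mu]_w (c%:E * (h n (X w))%:E)))%E; last first.
  rewrite -monotone_convergence//.
  - by apply: eq_integral => w _; apply/cvg_lim => //; exact: cvgeZl.
  - by move=> n; exact: emeasurable_funM (measurable_cst _) (mhX n).
  - by move=> n w _; rewrite mule_ge0// lee_fin.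
  - by move=> w _ m n mn; rewrite lee_wpmul2l ?lee_fin ?ndh.
congr (lim (_ @ \oo)); apply/funext => n.
have mI r : measurable_fun setT (fun w => (r * \1_(h n @^-1` [set r]) (X w))%:E).
  apply/measurable_EFinP; apply: measurable_funM => //.
  exact: measurableT_comp mX.
have mXr r : measurable (X @^-1` (h n @^-1` [set r])).
  by rewrite -[X in measurable X]setTI; exact: mX.
transitivity (\int[mu]_w (\sum_(r \in range (h n))
    ((r * \1_(h n @^-1` [set r]) (X w))%:E * (g w)%:E)))%E.
  apply: eq_integral => w _; rewrite fimfunE -fsumEFin// ge0_mule_fsuml//.
  by move=> r; exact: nnfun_muleindic_ge0.
rewrite ge0_integral_fsum//; last 2 first.
- by move=> r; exact: emeasurable_funM (mI r) mg'.
- by move=> r w _; rewrite mule_ge0 ?lee_fin//; exact: nnfun_muleindic_ge0.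
transitivity (\int[mu]_w (\sum_(r \in range (h n))
    (c%:E * (r * \1_(h n @^-1` [set r]) (X w))%:E)))%E; last first.
  apply: eq_integral => w _; rewrite [in RHS]fimfunE -fsumEFin// ge0_mule_fsumr//.
  by move=> r; exact: nnfun_muleindic_ge0.
rewrite ge0_integral_fsum//; last 2 first.
- by move=> r; exact: emeasurable_funM (measurable_cst _) (mI r).
- by move=> r w _; rewrite mule_ge0 ?lee_fin//; exact: nnfun_muleindic_ge0.
apply: eq_fsbigr => r; rewrite inE => -[y _ yr].
have r0 : 0 <= r by rewrite -yr.
pose E := X @^-1` (h n @^-1` [set r]).
transitivity (\int[mu]_w (r%:E * ((EFin \o g) \_ E) w))%E.
  apply: eq_integral => w _; rewrite EFinM -muleA; congr (_ * _)%E.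
  by rewrite epatch_indic muleC.
rewrite ge0_integralZl_EFin//; last 2 first.
- by move=> w _; apply: erestrict_ge0 => x _; rewrite lee_fin.
- by apply/(measurable_restrictT _ (mXr r)); exact: measurable_funTS.
rewrite -integral_mkcond Xg//.
transitivity (\int[mu]_w ((c * r)%:E * (\1_E w)%:E))%E; last first.
  by apply: eq_integral => w _; rewrite !EFinM muleA.
rewrite ge0_integralZl_EFin ?mulr_ge0//.
- by rewrite integral_indic ?setIT//; [rewrite EFinM muleCA muleA|exact: mXr].
- by apply/measurable_EFinP; exact: measurable_indic (mXr r).
Qed.

Context (P : probability T R).

Lemma mutually_independent_seq (X : nat -> {RV P >-> R}) (t : seq nat)
    (B : nat -> set R) :
  mutually_independent X -> uniq t -> (forall i, measurable (B i)) ->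
  (P (\bigcap_(i in [set` t]) (X i @^-1` B i)) =
   \prod_(i <- t) P (X i @^-1` B i))%E.
Proof.
move=> indX ut mB; have := indX [fset i | i in t]%fset B mB.
rewrite (_ : [set` [fset i | i in t]%fset] = [set` t]); last first.
  by apply/seteqP; split => i /=; rewrite !inE.
move=> ->; apply: perm_big; apply: uniq_perm => // i.
by rewrite !inE.
Qed.

(** The events indexed by [t] make the induction on [s] possible: to split off the factor [i], the
    remaining product must be integrated over events of [X i], which is the induction hypothesis
    with [i] moved from [s] to [t]. *)
Lemma integral_prod_indep_cond (X : nat -> {RV P >-> R}) (f : nat -> R -> R)
    (m : nat -> R) (s t : seq nat) (B : nat -> set R) :
    mutually_independent X ->
    (forall i, measurable_fun setT (f i)) -> (forall i x, 0 <= f i x) ->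
    (forall i, \int[P]_w (f i (X i w))%:E = (m i)%:E)%E ->
    uniq (s ++ t) -> (forall i, measurable (B i)) ->
  (\int[P]_(w in \bigcap_(i in [set` t]) (X i @^-1` B i))
     (\prod_(i <- s) f i (X i w))%:E =
   (\prod_(i <- s) m i)%:E * \prod_(i <- t) P (X i @^-1` B i))%E.
Proof.
move=> indX mf f0 fm.
have m0 i : 0 <= m i.
  by rewrite -lee_fin -fm integral_ge0// => w _; rewrite lee_fin.
have mfX i : measurable_fun setT (fun w => f i (X i w)).
  by apply: measurableT_comp.
have mcap t' B' : (forall i, measurable (B' i)) ->
    measurable (\bigcap_(i in [set` t']) (X i @^-1` B' i)).
  move=> mB'; apply: bigcap_measurableType => j _.
  by rewrite -[X in measurable X]setTI; exact: measurable_funP.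
elim: s t B => [|i s ih] t B ust mB.
  under eq_integral do rewrite big_nil.
  rewrite integral_cst/=; last exact: mcap.
  rewrite big_nil !mul1e; apply: mutually_independent_seq => //.
set D := \bigcap_(j in [set` t]) (X j @^-1` B j).
have mD : measurable D by exact: mcap.
pose F w := \prod_(j <- s) f j (X j w).
have mF : measurable_fun setT F by apply: measurable_prod.
have F0 w : 0 <= F w by apply: prodr_ge0.
pose c := (\prod_(j <- s) m j) * \prod_(j <- t) fine (P (X j @^-1` B j)).
have c0 : 0 <= c by rewrite mulr_ge0 ?prodr_ge0// => j _; rewrite fine_ge0.
have cE : (c%:E = (\prod_(j <- s) m j)%:E * \prod_(j <- t) P (X j @^-1` B j))%E.
  rewrite EFinM; congr (_ * _)%E; elim: (t) => [|j t' iht].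
    by rewrite !big_nil.
  rewrite !big_cons EFinM iht fineK// fin_num_measure//.
  by rewrite -[X in measurable X]setTI; exact: measurable_funP.
have it : i \notin t.
  by move: ust; rewrite /= mem_cat negb_or => /andP[/andP[]].
have FD w : ((F \_ D) w)%:E = ((EFin \o F) \_ D) w.
  by rewrite /patch; case: ifPn.
have -> : (\int[P]_(w in D) (\prod_(j <- i :: s) f j (X j w))%:E =
    \int[P]_w ((f i (X i w))%:E * ((F \_ D) w)%:E))%E.
  rewrite integral_mkcond; apply: eq_integral => w _.
  by rewrite /patch; case: ifPn => _; rewrite ?mule0//= big_cons EFinM.
rewrite (@ge0_integralM_indep _ _ P (X i) (F \_ D) c (EFin \o f i))//.
- by rewrite /= fm cE big_cons EFinM muleC muleA.
- apply/measurable_EFinP; rewrite (_ : _ \o _ = (EFin \o F) \_ D); last exact/funext.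
  by apply/(measurable_restrictT _ mD)/measurable_funTS/measurable_EFinP.
- by move=> w; rewrite /patch; case: ifPn.
- move=> B0 mB0.
  under eq_integral do rewrite FD.
  rewrite -integral_mkcondr.
  (* The event [B0] on [X i] is added to the family; as [i] is not in [t], the events already there
     are unchanged. *)
  pose B' j := if j == i then B0 else B j.
  have mB' j : measurable (B' j) by rewrite /B'; case: ifPn.
  have -> : X i @^-1` B0 `&` D = \bigcap_(j in [set` i :: t]) (X j @^-1` B' j).
    apply/seteqP; split => w.
      move=> [wB wD] j /=; rewrite /B' inE; case: eqVneq => [->//|_ /=].
      exact: wD.
    move=> h; split; first by have := h i; rewrite /= inE eqxx /B' eqxx; exact.
    move=> j jt; have := h j; rewrite /= inE jt orbT /B'; case: eqVneq => [ji|_]; last exact.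
    by move: it; rewrite -ji; rewrite /= in jt; rewrite jt.
  rewrite ih//; last by rewrite -(cat1s i t) uniq_catCA.
  rewrite big_cons {1}/B' eqxx cE -muleA; congr (_ * _)%E.
  rewrite muleC; congr (_ * _)%E; apply: eq_big_seq => j jt.
  by rewrite /B'; case: eqVneq => // ji; rewrite -ji jt in it.
- by apply/measurable_EFinP.
- by move=> y; rewrite lee_fin.
Qed.

Lemma integral_prod_indep (X : nat -> {RV P >-> R}) (f : nat -> R -> R)
    (m : nat -> R) (s : seq nat) :
    mutually_independent X ->
    (forall i, measurable_fun setT (f i)) -> (forall i x, 0 <= f i x) ->
    (forall i, \int[P]_w (f i (X i w))%:E = (m i)%:E)%E -> uniq s ->
  (\int[P]_w (\prod_(i <- s) f i (X i w))%:E = (\prod_(i <- s) m i)%:E)%E.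
Proof.
move=> indX mf f0 fm us.
have := @integral_prod_indep_cond X f m s [::] (fun=> setT) indX mf f0 fm.
rewrite cats0 big_nil mule1 (_ : \bigcap_(i in _) _ = setT); first exact.
by apply/seteqP; split.
Qed.

End Independence.

(** From e^u - 1 <= u e^u one gets e^u <= 1 + u + u (e^u - 1). The last term is at most u^2 e^u if u
    >= 0 and at most u^2 if u < 0. The separate [v] gives one majorant for both signs of [u]. *)
Lemma expR_le_quadratic (R : realType) (u v : R) : `|u| <= v ->
  expR u <= 1 + u + u ^+ 2 * expR v.
Proof.
move=> uv.
have uev : expR u <= expR v by rewrite ler_expR (le_trans (ler_norm u)).
have ev1 : 1 <= expR v.
  by have := expR_ge1Dx v; have := le_trans (normr_ge0 u) uv; lra.
have e1 : expR u - 1 <= u * expR u.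
  have := expR_ge1Dx (- u); have := expR_gt0 u; rewrite expRN => u0 h.
  have := ler_wpM2r (ltW u0) h; rewrite mulVf ?lt0r_neq0//; lra.
have e2 := expR_ge1Dx u.
have [u0|u0] := leP 0 u; first by nra.
have : expR u <= 1 by rewrite expR_le1 ltW.
by have := expR_gt0 u; nra.
Qed.

(** * Chernoff's bound for the sample mean *)

Section Chernoff.
Context (d : measure_display) (T : measurableType d) (R : realType)
  (P : probability T R).

Lemma mmt_gen_fun_integral (Y : T -> R) (t : R) :
  ('M_P Y t = \int[P]_w (expR (t * Y w))%:E)%E.
Proof.
rewrite /mmt_gen_fun unlock; apply: eq_integral => w _ /=.
by rewrite mulrC.
Qed.

(** The quadratic bound on the exponential with u = t Y and v = t0 Y leaves (t Y)^2 exp(t0 Y). A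
    second factor exp(t0 Y) absorbs the square through x^2 / 2 <= e^x, hence the moment at [2 * t0].
    As Y >= 0, this moment also serves negative [t]. *)
Lemma mmt_gen_fun_quadratic (Y : {RV P >-> R}) (nu t0 : R) :
    (forall w, 0 <= Y w) -> ('E_P[Y] = nu%:E)%E -> 0 < t0 ->
    ('M_P Y (2 * t0) < +oo)%E ->
  exists2 K, 0 < K & forall t, `|t| <= t0 ->
    ('M_P Y t <= (expR (t * nu + K * t ^+ 2))%:E)%E.
Proof.
move=> Y0 EY t00 M0.
have mexp t : measurable_fun setT (fun w => expR (t * Y w)).
  by apply: measurableT_comp => //; exact: measurable_funM.
pose M := fine ('M_P Y (2 * t0)).
have ME : (\int[P]_w (expR (2 * t0 * Y w))%:E = M%:E)%E.
  rewrite -mmt_gen_fun_integral fineK// ge0_fin_numE// mmt_gen_fun_integral.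
  by apply: integral_ge0 => w _; rewrite lee_fin expR_ge0.
have M0' : 0 <= M.
  by rewrite -lee_fin -ME integral_ge0// => w _; rewrite lee_fin expR_ge0.
have iY : P.-integrable setT (EFin \o Y).
  apply/integrableP; split; first exact/measurable_EFinP.
  under eq_integral do rewrite /= ger0_norm//.
  by rewrite -expectation_def EY ltry.
have iE : P.-integrable setT (EFin \o (fun w => expR (2 * t0 * Y w))).
  apply/integrableP; split; first exact/measurable_EFinP/mexp.
  under eq_integral do rewrite /= ger0_norm ?expR_ge0//.
  by rewrite ME ltry.
(* The summand 1 secures positivity of [K] from M >= 0. *)
pose K := 2 / t0 ^+ 2 * M + 1.
have q0 : 0 <= 2 / t0 ^+ 2 by rewrite divr_ge0 ?sqr_ge0.
exists K; first by have := mulr_ge0 q0 M0'; rewrite /K; lra.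
move=> t tt0; rewrite mmt_gen_fun_integral.
pose c := 2 / t0 ^+ 2 * t ^+ 2.
have c0 : 0 <= c by rewrite mulr_ge0 ?sqr_ge0.
apply: (@le_trans _ _ (\int[P]_w ((1 + t * Y w)%:E + (c * expR (2 * t0 * Y w))%:E)))%E.
  apply: ge0_le_integral => //.
  - exact/measurable_EFinP/mexp.
  - apply: emeasurable_funD; apply/measurable_EFinP.
      by apply: measurable_funD => //; exact: measurable_funM.
    by apply: measurable_funM => //; exact: mexp.
  - move=> w _; rewrite -EFinD lee_fin.
    have v0 : 0 <= t0 * Y w by rewrite mulr_ge0// ltW.
    have uv : `|t * Y w| <= t0 * Y w by rewrite normrM (ger0_norm (Y0 w)) ler_wpM2r.
    apply: (le_trans (expR_le_quadratic uv)); rewrite lerD2l.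
    have -> : 2 * t0 * Y w = t0 * Y w + t0 * Y w by ring.
    rewrite expRD /c.
    have -> : (t * Y w) ^+ 2 = t ^+ 2 / t0 ^+ 2 * (t0 * Y w) ^+ 2.
      by field; rewrite lt0r_neq0.
    have := expR_ge1Dxn 1 v0.
    rewrite (_ : 2`! = 2%N)// => h.
    have -> : 2 / t0 ^+ 2 * t ^+ 2 * (expR (t0 * Y w) * expR (t0 * Y w)) =
      t ^+ 2 / t0 ^+ 2 * (2 * expR (t0 * Y w)) * expR (t0 * Y w) by ring.
    rewrite ler_wpM2r ?expR_ge0// ler_wpM2l ?divr_ge0 ?sqr_ge0//; lra.
have i0 : P.-integrable setT (fun=> 1%:E).
  by apply: (finite_measure_integrable_cst P 1).
have i1 : P.-integrable setT (fun w => (1 + t * Y w)%:E).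
  under eq_fun do rewrite EFinD EFinM.
  by apply: integrableD => //; exact: integrableZl.
rewrite integralD//; last first.
  by under eq_fun do rewrite EFinM; exact: integrableZl.
rewrite [X in (X + _)%E](_ : _ = (1 + t * nu)%:E); last first.
  under eq_integral do rewrite EFinD EFinM.
  rewrite integralD//; last exact: integrableZl.
  rewrite integral_cst// mul1e integralZl// -expectation_def EY -EFinM.
  by rewrite EFinD; congr (_ + _)%E; exact: probability_setT.
rewrite [X in (_ + X)%E](_ : _ = (c * M)%:E); last first.
  under eq_integral do rewrite EFinM.
  rewrite ge0_integralZl_EFin ?ME//.
  - exact/measurable_EFinP/mexp.
rewrite -EFinD lee_fin; apply: le_trans (expR_ge1Dx _).
rewrite -addrA !lerD2l /K /c; have := sqr_ge0 t; lra.
Qed.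

Lemma eq_mmt_gen_fun (X Y : {RV P >-> R}) (t : R) :
    (forall B, measurable B -> distribution P X B = distribution P Y B) ->
  ('M_P X t = 'M_P Y t)%E.
Proof.
move=> XY; rewrite !mmt_gen_fun_integral.
have mf : measurable_fun setT (fun x : R => (expR (t * x))%:E).
  apply/measurable_EFinP; apply: measurableT_comp => //; exact: measurable_funM.
have f0 y : (0 <= (expR (t * y))%:E)%E by rewrite lee_fin expR_ge0.
have := ge0_integral_distribution X mf f0.
rewrite (eq_measure_integral (distribution P Y)) => [|B mB _]; last exact: XY.
by rewrite ge0_integral_distribution// => /esym.
Qed.

(** Markov's inequality for the exponential, with independence turning the moment of the sum into a
    power. The sign of [t] is free, so both tails are covered. *)
Lemma chernoff_sum (X : nat -> {RV P >-> R}) (t M r : R) (s : seq nat) :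
    iid X -> uniq s -> 0 <= M -> ('M_P (X 0%N) t <= M%:E)%E ->
  (P [set w | (r <= t * \sum_(i <- s) X i w)%R] <=
     (M ^+ size s * expR (- r))%:E)%E.
Proof.
move=> [indX idX] us M0 XM.
pose m := fine ('M_P (X 0%N) t).
have mE i : (\int[P]_w (expR (t * X i w))%:E = m%:E)%E.
  rewrite -mmt_gen_fun_integral (eq_mmt_gen_fun (Y := X 0%N)); last first.
    by move=> B mB; exact: idX.
  rewrite fineK// ge0_fin_numE; first exact: le_lt_trans XM (ltry _).
  by rewrite mmt_gen_fun_integral integral_ge0// => w _; rewrite lee_fin expR_ge0.
have m0 : 0 <= m.
  by rewrite -lee_fin -(mE 0%N) integral_ge0// => w _; rewrite lee_fin expR_ge0.
have mM : m <= M.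
  by rewrite -lee_fin -(mE 0%N) -mmt_gen_fun_integral.
have mS : measurable_fun setT (fun w => t * \sum_(i <- s) X i w).
  by apply: measurable_funM => //; exact: measurable_sum.
have prodE w : expR (t * \sum_(i <- s) X i w) = \prod_(i <- s) expR (t * X i w).
  by rewrite mulr_sumr expR_sum.
have intE : (\int[P]_w (expR (t * \sum_(i <- s) X i w))%:E = (m ^+ size s)%:E)%E.
  under eq_integral do rewrite prodE.
  rewrite (@integral_prod_indep _ _ _ P X (fun _ x => expR (t * x)) (fun=> m))//.
  - by rewrite big_const_seq count_predT -Monoid.iteropE.
  - by move=> i; apply: measurableT_comp => //; exact: measurable_funM.
set A := [set w | _].
have mA : measurable A.
  rewrite (_ : A = setT `&` (fun w => t * \sum_(i <- s) X i w) @^-1` `[r, +oo[).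
    exact: mS.
  by rewrite setTI; apply/seteqP; split => w /=; rewrite in_itv/= andbT.
have -> : P A = (\int[P]_w (\1_A w)%:E)%E by rewrite integral_indic// setIT.
apply: (@le_trans _ _ (\int[P]_w ((expR (- r))%:E *
    (expR (t * \sum_(i <- s) X i w))%:E)))%E.
  apply: ge0_le_integral => //.
  - by apply/measurable_EFinP; exact: measurable_indic.
  - by apply/measurable_EFinP/measurable_funM => //; exact: measurableT_comp.
  - move=> w _; rewrite -EFinM lee_fin indicE; case: (boolP (w \in A)).
      rewrite inE /A/= => wA; rewrite -expRD -[leLHS]expR0 ler_expR; lra.
    by rewrite mulr_ge0 ?expR_ge0.
rewrite ge0_integralZl_EFin ?expR_ge0//; last first.
  by apply/measurable_EFinP; exact: measurableT_comp.
rewrite intE -EFinM lee_fin mulrC ler_wpM2r ?expR_ge0//.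
by rewrite lerXn2r ?nnegrE.
Qed.

Lemma sample_mean_concentration (X : nat -> {RV P >-> R}) (nu : R) :
    iid X -> (forall i w, 0 <= X i w) -> ('E_P[X 0%N] = nu%:E)%E ->
    (exists U : set R, [/\ open U, U 0 &
       forall t : R, U t -> ('M_P (X 0%N) t < +oo)%E]) ->
  exists K u0 : R, [/\ 0 < K, 0 < u0 & forall (m : nat) (u : R),
    (0 < m)%N -> 0 < u <= u0 ->
    ((P [set w | (nu + u <= sample_mean X m w)%R] <= (expR (- (m%:R * u ^+ 2 * K)))%:E)%E /\
     (P [set w | (sample_mean X m w <= nu - u)%R] <= (expR (- (m%:R * u ^+ 2 * K)))%:E)%E)].
Proof.
move=> iX X0 EX [U [oU U0 MU]].
have [t0 t00 /MU Mt0] : exists2 t0, 0 < t0 & U (2 * t0).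
  have [e /= e0 eU] := open_subball oU U0.
  have e2 : 0 < e / 2 by rewrite divr_gt0.
  exists (e / 8); first by rewrite divr_gt0.
  apply: (eU (e / 2)) => //=.
    by rewrite /ball_/= sub0r normrN gtr0_norm//; lra.
  by rewrite /ball/= sub0r normrN gtr0_norm; lra.
have [K K0 MK] := mmt_gen_fun_quadratic (X0 0%N) EX t00 Mt0.
(* The minimum of K t^2 - t u is - u^2 / (4 K), attained at t = u / (2 K); the bound on [u] says
   that this [t] is at most [t0]. *)
exists (4 * K)^-1, (2 * K * t0); split.
- by rewrite invr_gt0 mulr_gt0.
- by rewrite !mulr_gt0.
move=> m u m0 /andP[u0 uK].
have m0' : 0 < m%:R :> R by rewrite ltr0n.
(* [t] minimises the Chernoff exponent [K t ^ 2 - t u]; the lower tail uses [- t]. *)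
pose t := u / (2 * K).
have tE : t * (2 * K) = u by rewrite /t divfK// lt0r_neq0// mulr_gt0.
have tpos : 0 < t by rewrite divr_gt0// mulr_gt0.
have tt0 : t <= t0 by rewrite ler_pdivrMr ?mulr_gt0// mulrC.
move: t tE tpos tt0 => t tE tpos tt0.
have us : uniq (index_iota 1 m.+1) by exact: iota_uniq.
have key s r : `|s| <= t0 ->
    (P [set w | (r <= s * \sum_(1 <= i < m.+1) X i w)%R] <=
     (expR (m%:R * (s * nu + K * s ^+ 2) - r))%:E)%E.
  move=> st0; have := chernoff_sum r iX us (expR_ge0 _) (MK _ st0).
  by rewrite size_iota subn1/= -expRM_natl -expRD.
have e4 : K * t ^+ 2 = u ^+ 2 / (4 * K).
  by rewrite -tE; field; rewrite lt0r_neq0.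
split.
- have := key t (t * (m%:R * (nu + u))); rewrite (gtr0_norm tpos) => /(_ tt0).
  have -> : [set w | t * (m%:R * (nu + u)) <= t * \sum_(1 <= i < m.+1) X i w] =
      [set w | nu + u <= sample_mean X m w].
    apply/seteqP; split => w /=; rewrite /sample_mean (ler_pM2l tpos).
      by rewrite ler_pdivlMl.
    by rewrite ler_pdivlMl.
  move=> /le_trans; apply; rewrite lee_fin ler_expR -mulrA -e4 -tE.
  by rewrite le_eqVlt; apply/orP; left; apply/eqP; ring.
- have := key (- t) (- t * (m%:R * (nu - u))); rewrite normrN (gtr0_norm tpos) => /(_ tt0).
  have -> : [set w | - t * (m%:R * (nu - u)) <= - t * \sum_(1 <= i < m.+1) X i w] =
      [set w | sample_mean X m w <= nu - u].
    apply/seteqP; split => w /=; rewrite /sample_mean !mulNr lerN2 (ler_pM2l tpos).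
      by rewrite ler_pdivrMl.
    by rewrite ler_pdivrMl.
  move=> /le_trans; apply; rewrite lee_fin ler_expR sqrrN -mulrA -e4 -tE.
  by rewrite le_eqVlt; apply/orP; left; apply/eqP; ring.
Qed.

End Chernoff.

(** * From a fixed rate to a random rate *)

Section MixedPoissonTail.
Context (d : measure_display) (T : measurableType d) (R : realType)
  (P : probability T R).

Lemma measurable_poisson_head k : measurable_fun setT (@poisson_head R k).
Proof.
apply: measurable_sum => i; apply: measurable_funM.
  by apply: measurableT_comp => //; exact: measurableT_comp.
by apply: measurable_funM => //; exact: measurable_funX.
Qed.

Lemma measurable_poisson_tail (Y : T -> R) k :
    measurable_fun setT Y -> (forall w, 0 <= Y w) ->
  measurable_fun setT (fun w => poisson_tail (Y w) k).
Proof.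
move=> mY Y0; rewrite (_ : (fun _ => _) =
    EFin \o (fun w => 1 - poisson_head k (Y w))); last first.
  by apply/funext => w; rewrite poisson_tail_head.
apply/measurable_EFinP; apply: measurable_funB => //.
by apply: measurableT_comp mY; exact: measurable_poisson_head.
Qed.

Lemma mixed_poisson_tail (Y : T -> R) (Z : {RV P >-> nat}) k :
    mixed_poisson Y Z ->
  (P (Z @^-1` [set n | (k <= n)%N]) = \int[P]_w poisson_tail (Y w) k)%E.
Proof.
move=> /(_ setT [set n | (k <= n)%N] measurableT).
by rewrite preimage_setT setTI.
Qed.

(** Integrate a pointwise bound on the tail at rate [Y]: below [y] it is at most the tail at [y],
    above [y] at most 1. *)
Lemma mixed_poisson_tail_ub (Y : T -> R) (Z : {RV P >-> nat}) k y :
    measurable_fun setT Y -> (forall w, 0 <= Y w) -> mixed_poisson Y Z ->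
    0 <= y ->
  (P (Z @^-1` [set n | (k <= n)%N]) <=
   poisson_tail y k + P [set w | (y <= Y w)%R])%E.
Proof.
move=> mY Y0 YZ y0; rewrite (mixed_poisson_tail k YZ).
set A := [set w | _].
have mA : measurable A.
  rewrite (_ : A = setT `&` Y @^-1` `[y, +oo[); first exact: mY.
  by rewrite setTI; apply/seteqP; split => w /=; rewrite in_itv/= andbT.
apply: (@le_trans _ _ (\int[P]_w (poisson_tail y k + (\1_A w)%:E)))%E.
  apply: ge0_le_integral => //.
  - exact: measurable_poisson_tail.
  - by apply: emeasurable_funD => //; exact/measurable_EFinP/measurable_indic.
  - move=> w _; rewrite indicE; case: (boolP (w \in A)) => [_|].
      apply: (@le_trans _ _ 1%E); first exact: probability_le1.
      by rewrite leeDr// measure_ge0.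
    rewrite notin_setE/= => /negP; rewrite -ltNge => /ltW Yy.
    by rewrite adde0 poisson_tail_le.
rewrite ge0_integralD//; last first.
  by apply/measurable_EFinP/measurable_indic.
rewrite integral_cst// integral_indic// setIT; apply: leeD => //.
rewrite -[leRHS]mule1; apply: lee_wpmul2l; first exact: measure_ge0.
exact: probability_le1.
Qed.

Lemma mixed_poisson_tail_lb (Y : T -> R) (Z : {RV P >-> nat}) k y :
    measurable_fun setT Y -> (forall w, 0 <= Y w) -> mixed_poisson Y Z ->
    0 <= y ->
  (poisson_tail y k * P [set w | (y <= Y w)%R] <=
   P (Z @^-1` [set n | (k <= n)%N]))%E.
Proof.
move=> mY Y0 YZ y0; rewrite (mixed_poisson_tail k YZ).
set A := [set w | _].
have mA : measurable A.
  rewrite (_ : A = setT `&` Y @^-1` `[y, +oo[); first exact: mY.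
  by rewrite setTI; apply/seteqP; split => w /=; rewrite in_itv/= andbT.
have t0 y' : (0 <= poisson_tail y' k)%E by exact: measure_ge0.
have -> : (poisson_tail y k * P A =
    \int[P]_w (poisson_tail y k * (\1_A w)%:E))%E.
  rewrite ge0_integralZl//; last first.
    by apply/measurable_EFinP; exact: measurable_indic.
  by rewrite integral_indic// setIT.
apply: ge0_le_integral => //.
- by move=> w _; rewrite mule_ge0// lee_fin indicE.
- by apply: measurable_funeM; exact/measurable_EFinP/measurable_indic.
- exact: measurable_poisson_tail.
- move=> w _; rewrite indicE; case: (boolP (w \in A)) => [|_].
    by rewrite inE/= => /(poisson_tail_le k y0); rewrite mule1.
  by rewrite mule0.
Qed.

End MixedPoissonTail.

(** * Normalisation by exp(N I) sqrt N, and the limits in N *)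

Section RateScaling.
Context {R : realType}.
Implicit Types (a nu N y : R).

(** Apart from [stirling_rem k], the exponent on the right is the log-likelihood ratio at [k] of the
    rates [y] and N nu; the normalisation cancels everything else but [sqrt a]. *)
Lemma poisson_mass_rate a nu N y k : 0 < a -> 0 < nu -> 0 < N -> 0 < y ->
    N * a = k%:R ->
  poisson_mass y k * (expR (N * rate_fun a nu) * Num.sqrt N) =
  expR (N * nu - y + N * a * ln (y / (N * nu)) - stirling_rem k) / Num.sqrt a.
Proof.
move=> a0 nu0 N0 y0 Nak.
have k0 : (0 < k)%N by rewrite -(ltr0n R) -Nak mulr_gt0.
rewrite poisson_mass_stirling// -Nak sqrtrM ?(ltW N0)//.
have sN : Num.sqrt N != 0 by rewrite lt0r_neq0// sqrtr_gt0.
have sa : Num.sqrt a != 0 by rewrite lt0r_neq0// sqrtr_gt0.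
rewrite (_ : _ * _ = expR (N * a - y + N * a * ln (y / (N * a)) - stirling_rem k) *
  expR (N * rate_fun a nu) / Num.sqrt a); last by field; rewrite sN sa.
rewrite -expRD; congr (expR _ / _).
rewrite /rate_fun !ln_div ?posrE ?mulr_gt0// !lnM ?posrE//.
by ring.
Qed.

(** By ln (1 + t) <= t the log-likelihood ratio at N nu + dlt is at most dlt (a / nu - 1), uniformly
    in [N]. *)
Lemma poisson_tail_rate_ub a nu N dlt k : 0 < nu -> nu < a -> 0 < N -> 0 < dlt ->
    N * nu + dlt < N * a -> N * a = k%:R ->
  (poisson_tail (N * nu + dlt) k <= (
     (1 - (nu + dlt / N) / a)^-1 *
     (expR (dlt * (a / nu - 1) - stirling_rem k) / Num.sqrt a) /
     (expR (N * rate_fun a nu) * Num.sqrt N))%:E)%E.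
Proof.
move=> nu0 nua N0 d0 yk Nak.
have a0 := lt_trans nu0 nua.
have y0 : 0 < N * nu + dlt by rewrite addr_gt0// mulr_gt0.
apply: (le_trans (poisson_tail_ub y0 _)); first by rewrite -Nak.
have E0 : 0 < expR (N * rate_fun a nu) * Num.sqrt N.
  by rewrite mulr_gt0 ?expR_gt0// sqrtr_gt0.
rewrite lee_fin ler_pdivlMr// -mulrA (poisson_mass_rate a0 nu0 N0 y0 Nak) -Nak.
rewrite (_ : (N * nu + dlt) / (N * a) = (nu + dlt / N) / a); last first.
  by field; rewrite !lt0r_neq0.
have q1 : (nu + dlt / N) / a < 1.
  rewrite ltr_pdivrMr// mul1r -(ltr_pM2l N0) mulrDr; move: yk.
  by rewrite [N * (_ / N)]mulrC divfK// lt0r_neq0.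
rewrite ler_wpM2l ?invr_ge0 ?subr_ge0 ?(ltW q1)//.
rewrite ler_wpM2r ?invr_ge0 ?sqrtr_ge0// ler_expR lerD2r.
have -> : (N * nu + dlt) / (N * nu) = 1 + dlt / (N * nu).
  by field; rewrite !lt0r_neq0.
have t0 : 0 < dlt / (N * nu) by rewrite divr_gt0// mulr_gt0.
have h : ln (1 + dlt / (N * nu)) <= dlt / (N * nu) by apply: le_ln1Dx; lra.
have := ler_wpM2l (ltW (mulr_gt0 N0 a0)) h.
rewrite (_ : N * a * (dlt / (N * nu)) = dlt * (a / nu)); last first.
  by field; rewrite !lt0r_neq0.
by rewrite mulrBr mulr1; lra.
Qed.

Lemma poisson_tail_rate_lb a nu N dlt k J : 0 < nu -> nu < a -> 0 < N -> 0 < dlt ->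
    dlt < N * nu -> N * a = k%:R ->
  (((\sum_(i < J) ((nu - dlt / N) / (a + J%:R / N)) ^+ i) *
     (expR (dlt - a * dlt / (nu - dlt / N) - stirling_rem k) / Num.sqrt a) /
     (expR (N * rate_fun a nu) * Num.sqrt N))%:E <=
   poisson_tail (N * nu - dlt) k)%E.
Proof.
move=> nu0 nua N0 d0 dN Nak.
have a0 := lt_trans nu0 nua.
have y0 : 0 < N * nu - dlt by rewrite subr_gt0.
apply: le_trans (poisson_tail_lb k J y0).
have E0 : 0 < expR (N * rate_fun a nu) * Num.sqrt N.
  by rewrite mulr_gt0 ?expR_gt0// sqrtr_gt0.
rewrite lee_fin ler_pdivrMr// -[leRHS]mulrA (poisson_mass_rate a0 nu0 N0 y0 Nak).
have J0 : 0 <= J%:R :> R by [].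
rewrite natrD -Nak (_ : (N * nu - dlt) / (N * a + J%:R) =
    (nu - dlt / N) / (a + J%:R / N)); last first.
  by field; rewrite !lt0r_neq0//; have := mulr_gt0 N0 a0; lra.
have s0 : 0 < nu - dlt / N by rewrite subr_gt0 ltr_pdivrMr// mulrC.
have q0 : 0 <= (nu - dlt / N) / (a + J%:R / N).
  by rewrite divr_ge0 ?(ltW s0)// addr_ge0 ?(ltW a0)// divr_ge0// ltW.
have S0 : 0 <= \sum_(i < J) ((nu - dlt / N) / (a + J%:R / N)) ^+ i.
  by apply: sumr_ge0 => i _; exact: exprn_ge0.
rewrite ler_wpM2l//.
rewrite ler_wpM2r ?invr_ge0 ?sqrtr_ge0// ler_expR lerD2r.
(* Inverting turns the lower bound needed on this logarithm into the upper bound ln (1 + t) <= t. *)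
have -> : (N * nu - dlt) / (N * nu) = (1 + dlt / (N * nu - dlt))^-1.
  by field; rewrite !lt0r_neq0//; lra.
have t0 : 0 < dlt / (N * nu - dlt) by rewrite divr_gt0.
rewrite lnV ?posrE ?addr_gt0//.
have h : ln (1 + dlt / (N * nu - dlt)) <= dlt / (N * nu - dlt).
  by apply: le_ln1Dx; lra.
have := ler_wpM2l (ltW (mulr_gt0 N0 a0)) h.
rewrite (_ : N * a * (dlt / (N * nu - dlt)) = a * dlt / (nu - dlt / N)); last first.
  by field; rewrite !lt0r_neq0//; lra.
by rewrite mulrN; lra.
Qed.

Lemma cvgry_powR (r : R) : 0 < r -> N `^ r @[N --> +oo] --> +oo.
Proof.
move=> r0; apply/cvgryPge => A; near=> N.
have N0 : 0 <= N by near: N; exact: nbhs_pinfty_ge.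
have [A0|A0] := leP A 0; first by rewrite (le_trans A0)// powR_ge0.
rewrite -[leLHS](powRr1 (ltW A0)) -(mulVf (lt0r_neq0 r0)) powRrM.
rewrite ge0_ler_powR ?nnegrE ?powR_ge0 ?(ltW r0)//.
Unshelve. all: by end_near. Qed.

Lemma cvg_divr_pinfty (c : R) : c / N @[N --> +oo] --> 0.
Proof.
rewrite -[X in _ --> X](mulr0 c); apply: cvgMr.
apply/gtr0_cvgV0; last exact: cvg_id.
exact: nbhs_pinfty_gt.
Qed.

(** On admissible [N] the truncation equals N a; using it everywhere allows the limit along all real
    [N]. *)
Lemma cvg_stirling_rem_trunc a : 0 < a ->
  stirling_rem (Num.truncn (N * a)) @[N --> +oo] --> (ln (2 * pi) / 2 : R).
Proof.
move=> a0; apply: (cvg_comp _ _ _ (@cvg_stirling_rem R)).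
apply/cvgnyPge => n; near=> N.
have N0 : 0 <= N by near: N; exact: nbhs_pinfty_ge.
rewrite truncn_ge_nat ?mulr_ge0 ?(ltW a0)//.
by rewrite -ler_pdivrMr//; near: N; exact: nbhs_pinfty_ge.
Unshelve. all: by end_near. Qed.

Lemma cvg_concentration alpha dlt K : 2 < alpha -> 0 < dlt -> 0 < K ->
  expR (- (N `^ alpha * (dlt / N) ^+ 2 * K)) @[N --> +oo] --> (0 : R).
Proof.
move=> alpha2 d0 K0.
apply: (cvg_comp (fun N => N `^ alpha * (dlt / N) ^+ 2 * K) (fun x => expR (- x)));
  last exact: cvgr_expR.
have h : N `^ (alpha - 2) @[N --> +oo] --> +oo by apply: cvgry_powR; lra.
apply/cvgryPge => A; near=> N.
have N0 : 0 < N by near: N; exact: nbhs_pinfty_gt.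
have -> : N `^ alpha * (dlt / N) ^+ 2 * K = N `^ (alpha - 2) * (dlt ^+ 2 * K).
  rewrite powRB ?lt0r_neq0 ?implybT// powR_mulrn ?(ltW N0)//.
  by field; rewrite lt0r_neq0.
rewrite -ler_pdivrMr ?mulr_gt0 ?exprn_gt0//; near: N.
by move/cvgryPge : h; exact.
Unshelve. all: by end_near. Qed.

Lemma cvg_concentration_rate alpha dlt K I : 3 < alpha -> 0 < dlt -> 0 < K ->
  expR (N * I) * Num.sqrt N * expR (- (N `^ alpha * (dlt / N) ^+ 2 * K))
    @[N --> +oo] --> (0 : R).
Proof.
move=> alpha3 d0 K0.
have h : N `^ (alpha - 3) @[N --> +oo] --> +oo by apply: cvgry_powR; lra.
apply: (@squeeze_cvgr _ _ _ _ (fun=> 0) (fun N => expR (- N))); last 2 first.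
- exact: cvg_cst.
- exact: cvgr_expR.
near=> N.
have N1 : 1 <= N by near: N; exact: nbhs_pinfty_ge.
have N0 : 0 < N by lra.
rewrite !mulr_ge0 ?expR_ge0 ?sqrtr_ge0//=.
have sN : Num.sqrt N <= expR N.
  apply: (@le_trans _ _ N); last by have := expR_ge1Dx N; lra.
  rewrite -[leRHS]sqr_sqrtr ?(ltW N0)// expr2 ler_peMr ?sqrtr_ge0//.
  by rewrite -sqrtr1 ler_sqrt// ltW.
have -> : N `^ alpha * (dlt / N) ^+ 2 * K = N * (N `^ (alpha - 3) * (dlt ^+ 2 * K)).
  rewrite powRB ?lt0r_neq0 ?implybT// powR_mulrn ?(ltW N0)//.
  by field; rewrite lt0r_neq0.
apply: (@le_trans _ _ (expR (N * I) * expR N *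
    expR (- (N * (N `^ (alpha - 3) * (dlt ^+ 2 * K)))))).
  by rewrite ler_wpM2r ?expR_ge0// ler_wpM2l ?expR_ge0.
rewrite -!expRD ler_expR.
(* [I] pays for exp(N I), one unit for sqrt N <= e^N, and the other leaves e^(- N). *)
have : I + 2 <= N `^ (alpha - 3) * (dlt ^+ 2 * K).
  rewrite -ler_pdivrMr ?mulr_gt0 ?exprn_gt0//; near: N.
  by move/cvgryPge : h; exact.
move=> /(ler_wpM2l (ltW N0)); lra.
Unshelve. all: by end_near. Qed.

Lemma prefactor_gt0 a nu : 0 < nu -> nu < a -> 0 < prefactor a nu.
Proof.
move=> nu0 nua; have a0 := lt_trans nu0 nua.
rewrite mulr_gt0// invr_gt0 ?sqrtr_gt0 ?mulr_gt0 ?pi_gt0//.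
by rewrite subr_gt0 ltr_pdivrMr// mul1r.
Qed.

Lemma prefactorE a nu x : 0 < nu -> nu < a ->
  (1 - nu / a)^-1 * (expR (x - ln (2 * pi) / 2) / Num.sqrt a) =
  prefactor a nu * expR x.
Proof.
move=> nu0 nua; have a0 := lt_trans nu0 nua.
have p0 : 0 < 2 * pi :> R by rewrite mulr_gt0// pi_gt0.
rewrite expRB expR_half_ln// /prefactor [in RHS]sqrtrM ?(ltW p0)//.
by rewrite invfM; ring.
Qed.

Lemma cvg_tail_ub a nu alpha dlt K : 0 < nu -> nu < a -> 3 < alpha ->
    0 < dlt -> 0 < K ->
  (1 - (nu + dlt / N) / a)^-1 *
    (expR (dlt * (a / nu - 1) - stirling_rem (Num.truncn (N * a))) / Num.sqrt a) +
  expR (N * rate_fun a nu) * Num.sqrt N *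
    expR (- (N `^ alpha * (dlt / N) ^+ 2 * K)) @[N --> +oo] -->
  prefactor a nu * expR (dlt * (a / nu - 1)).
Proof.
move=> nu0 nua alpha3 d0 K0; have a0 := lt_trans nu0 nua.
rewrite -prefactorE// -[X in _ --> X]addr0; apply: cvgD; last first.
  exact: cvg_concentration_rate.
apply: cvgM.
  apply: cvgV; first by rewrite subr_eq0 eq_sym lt_eqF// ltr_pdivrMr// mul1r.
  apply: cvgB; first exact: cvg_cst.
  apply: cvgMl; rewrite -[X in _ --> X]addr0; apply: cvgD; first exact: cvg_cst.
  exact: cvg_divr_pinfty.
apply: cvgMl; apply: continuous_cvg; first exact: continuous_expR.
by apply: cvgB; [exact: cvg_cst|exact: cvg_stirling_rem_trunc].
Qed.

(** With [J] fixed the truncated geometric sum loses the factor 1 - (nu / a)^J; this loss and that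
    of the shift are made small afterwards, through [J] and [dlt]. *)
Lemma cvg_tail_lb a nu alpha dlt K J : 0 < nu -> nu < a -> 2 < alpha ->
    0 < dlt -> 0 < K ->
  (\sum_(i < J) ((nu - dlt / N) / (a + J%:R / N)) ^+ i) *
    (expR (dlt - a * dlt / (nu - dlt / N) -
      stirling_rem (Num.truncn (N * a))) / Num.sqrt a) *
  (1 - expR (- (N `^ alpha * (dlt / N) ^+ 2 * K))) @[N --> +oo] -->
  prefactor a nu * (expR (dlt * (1 - a / nu)) * (1 - (nu / a) ^+ J)).
Proof.
move=> nu0 nua alpha2 d0 K0; have a0 := lt_trans nu0 nua.
have q1 : 1 - nu / a != 0 by rewrite subr_eq0 eq_sym lt_eqF// ltr_pdivrMr// mul1r.
have -> : prefactor a nu * (expR (dlt * (1 - a / nu)) * (1 - (nu / a) ^+ J)) =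
  (\sum_(i < J) (nu / a) ^+ i) *
  (expR (dlt - a * dlt / nu - ln (2 * pi) / 2) / Num.sqrt a) * (1 - 0).
  rewrite mulrA -prefactorE//.
  have -> : \sum_(i < J) (nu / a) ^+ i = (1 - (nu / a) ^+ J) / (1 - nu / a).
    by apply: (canRL (mulfK q1)); have := subrX1 (nu / a) J; lra.
  rewrite (_ : dlt - a * dlt / nu = dlt * (1 - a / nu)); last by ring.
  by rewrite subr0; ring.
have cnu : nu - dlt / N @[N --> +oo] --> nu.
  rewrite -[X in _ --> X]subr0; apply: cvgB; first exact: cvg_cst.
  exact: cvg_divr_pinfty.
apply: cvgM; last first.
  by apply: cvgB; [exact: cvg_cst|exact: cvg_concentration].
apply: cvgM.
  have cq : (nu - dlt / N) / (a + J%:R / N) @[N --> +oo] --> nu / a.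
    apply: cvgM => //; apply: cvgV; first exact: lt0r_neq0.
    rewrite -[X in _ --> X]addr0; apply: cvgD; first exact: cvg_cst.
    exact: cvg_divr_pinfty.
  pose f (q : R) := \sum_(i < J) q ^+ i.
  have cf : continuous f.
    rewrite /f; elim: (J) => [|n ih] q.
      under eq_fun do rewrite big_ord0; exact: cvg_cst.
    rewrite (_ : (fun _ => _) = (fun q => \sum_(i < n) q ^+ i) + (fun q => q ^+ n)); last first.
      by apply/funext => ?; rewrite big_ord_recr.
    by apply: continuousD; [exact: ih|exact: exprn_continuous].
  exact: (continuous_cvg _ (cf (nu / a)) cq).
apply: cvgMl; apply: continuous_cvg; first exact: continuous_expR.
apply: cvgB; last exact: cvg_stirling_rem_trunc.
apply: cvgB; first exact: cvg_cst.
by apply: cvgMr; apply: cvgV => //; rewrite lt0r_neq0.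
Qed.
End RateScaling.

(** * Bounds on the normalised tail probability, up to any tolerance *)

Section TailBounds.
Context (R : realType) (d : measure_display) (T : measurableType d)
  (P : probability T R) (X : nat -> {RV P >-> R}) (nu a alpha K u0 : R)
  (Z : R -> {RV P >-> nat}).
Context (X_ge0 : forall i w, 0 <= X i w) (nu_gt0 : 0 < nu) (a_gt_nu : nu < a).
Context (K_gt0 : 0 < K).
Context (X_conc : forall (m : nat) (u : R), (0 < m)%N -> 0 < u <= u0 ->
  ((P [set w | (nu + u <= sample_mean X m w)%R] <=
    (expR (- (m%:R * u ^+ 2 * K)))%:E)%E /\
   (P [set w | (sample_mean X m w <= nu - u)%R] <=
    (expR (- (m%:R * u ^+ 2 * K)))%:E)%E)).
Context (Z_pois : forall N : R, admissible a alpha N ->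
  mixed_poisson
    (fun w => N * sample_mean X (Num.truncn (N `^ alpha)) w) (Z N)).

Let a_gt0 : 0 < a := lt_trans nu_gt0 a_gt_nu.

Lemma measurable_sample_mean m : measurable_fun setT (sample_mean X m).
Proof. by apply: measurable_funM => //; exact: measurable_sum. Qed.

Lemma sample_mean_ge0 m w : 0 <= sample_mean X m w.
Proof. by rewrite mulr_ge0 ?invr_ge0// sumr_ge0. Qed.

Lemma tail_probE N : admissible a alpha N ->
  ((tail_prob Z a N)%:E = P (Z N @^-1` [set n | (Num.truncn (N * a) <= n)%N]))%E.
Proof.
move=> [N0 Na _]; rewrite /tail_prob.
rewrite (_ : [set w | _] = Z N @^-1` [set n | (Num.truncn (N * a) <= n)%N]).
  rewrite fineK// fin_num_measure// -[X in measurable X]setTI.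
  exact: measurable_funP.
apply/seteqP; split => w /=; first by rewrite -{1}(truncnK Na) ler_nat.
by rewrite -{2}(truncnK Na) ler_nat.
Qed.

Lemma tail_prob_ub N dlt : admissible a alpha N -> 0 < dlt -> dlt / N <= u0 ->
    N * nu + dlt < N * a ->
  tail_prob Z a N * (expR (N * rate_fun a nu) * Num.sqrt N) <=
  (1 - (nu + dlt / N) / a)^-1 *
    (expR (dlt * (a / nu - 1) - stirling_rem (Num.truncn (N * a))) / Num.sqrt a) +
  expR (N * rate_fun a nu) * Num.sqrt N *
    expR (- (N `^ alpha * (dlt / N) ^+ 2 * K)).
Proof.
move=> adm d0 du dN; have [N0 Na Nal] := adm.
set E := expR (N * rate_fun a nu) * Num.sqrt N.
have E0 : 0 < E by rewrite mulr_gt0 ?expR_gt0// sqrtr_gt0.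
set m := Num.truncn (N `^ alpha).
have mE : m%:R = N `^ alpha by exact: truncnK.
have m0 : (0 < m)%N by rewrite -(ltr0n R) mE powR_gt0.
have y0 : 0 <= N * nu + dlt by rewrite addr_ge0 ?mulr_ge0 ?(ltW N0) ?ltW.
rewrite -ler_pdivlMr// mulrDl.
rewrite [E * _]mulrC mulfK ?lt0r_neq0// -lee_fin tail_probE// EFinD.
have mY : measurable_fun setT (fun w => N * sample_mean X m w).
  by apply: measurable_funM => //; exact: measurable_sample_mean.
have Y0 w : 0 <= N * sample_mean X m w.
  by rewrite mulr_ge0 ?(ltW N0)// sample_mean_ge0.
apply: (le_trans (mixed_poisson_tail_ub _ mY Y0 (Z_pois adm) y0)).
apply: leeD.
  by apply: poisson_tail_rate_ub => //; rewrite truncnK.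
rewrite -mE; have [|+ _] := X_conc m0 (u := dlt / N).
  by rewrite du divr_gt0.
apply: le_trans; rewrite le_eqVlt; apply/orP; left; apply/eqP; congr (P _).
have e : N * nu + dlt = N * (nu + dlt / N) by field; rewrite lt0r_neq0.
by apply/seteqP; split => w /=; rewrite e ler_pM2l.
Qed.

Lemma tail_prob_lb N dlt J : admissible a alpha N -> 0 < dlt -> dlt / N <= u0 ->
    dlt < N * nu ->
  (\sum_(i < J) ((nu - dlt / N) / (a + J%:R / N)) ^+ i) *
    (expR (dlt - a * dlt / (nu - dlt / N) -
      stirling_rem (Num.truncn (N * a))) / Num.sqrt a) *
  (1 - expR (- (N `^ alpha * (dlt / N) ^+ 2 * K))) <=
  tail_prob Z a N * (expR (N * rate_fun a nu) * Num.sqrt N).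
Proof.
move=> adm d0 du dN; have [N0 Na Nal] := adm.
set E := expR (N * rate_fun a nu) * Num.sqrt N.
have E0 : 0 < E by rewrite mulr_gt0 ?expR_gt0// sqrtr_gt0.
set m := Num.truncn (N `^ alpha).
have mE : m%:R = N `^ alpha by exact: truncnK.
have m0 : (0 < m)%N by rewrite -(ltr0n R) mE powR_gt0.
have y0 : 0 <= N * nu - dlt by rewrite subr_ge0 ltW.
have mY : measurable_fun setT (fun w => N * sample_mean X m w).
  by apply: measurable_funM => //; exact: measurable_sample_mean.
have Y0 w : 0 <= N * sample_mean X m w.
  by rewrite mulr_ge0 ?(ltW N0)// sample_mean_ge0.
rewrite -ler_pdivrMr// mulrAC -lee_fin tail_probE//.
apply: le_trans (mixed_poisson_tail_lb _ mY Y0 (Z_pois adm) y0).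
rewrite EFinM.
have lb := @poisson_tail_rate_lb R a nu N dlt _ J nu_gt0 a_gt_nu N0 d0 dN
  (esym (truncnK Na)).
apply: (@le_trans _ _ (poisson_tail (N * nu - dlt) (Num.truncn (N * a)) *
    (1 - expR (- (N `^ alpha * (dlt / N) ^+ 2 * K)))%:E)%E).
  rewrite lee_wpmul2r// lee_fin subr_ge0 expR_le1 oppr_le0.
  by rewrite mulr_ge0 ?(ltW K_gt0)// mulr_ge0 ?powR_ge0 ?sqr_ge0.
apply: lee_wpmul2l; first exact: measure_ge0.
have [|_ +] := X_conc m0 (u := dlt / N); first by rewrite du divr_gt0.
rewrite mE; set B := [set w | _]; set A := [set w | _] => PB.
have mA : measurable A.
  rewrite (_ : A = setT `&` (fun w => N * sample_mean X m w) @^-1`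
    `[N * nu - dlt, +oo[); first exact: mY.
  by rewrite setTI; apply/seteqP; split => w /=; rewrite in_itv/= andbT.
(* The concentration bound controls the lower deviation [B]; covering the complement of [A] by it
   bounds the probability of [A] from below. *)
have AB : ~` A `<=` B.
  move=> w /negP; rewrite -ltNge /B/= => h; rewrite -(ler_pM2l N0).
  rewrite mulrBr [N * (_ / N)]mulrC divfK ?lt0r_neq0//; exact: ltW.
have mB : measurable B.
  rewrite (_ : B = setT `&` sample_mean X m @^-1` `]-oo, nu - dlt / N]).
    exact: measurable_sample_mean.
  by rewrite setTI; apply/seteqP; split => w /=; rewrite in_itv.
have PA : (P (~` A) <= (expR (- (N `^ alpha * (dlt / N) ^+ 2 * K)))%:E)%E.
  by apply: le_trans PB; rewrite le_measure ?inE//; exact: measurableC.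
rewrite probability_setC// in PA.
move: PA; rewrite -(fineK (fin_num_measure P A mA)) -EFinB !lee_fin; lra.
Qed.

Let C_gt0 : 0 < prefactor a nu := prefactor_gt0 nu_gt0 a_gt_nu.

Context (u0_gt0 : 0 < u0).

Lemma near_tail_prob_ub e : 3 < alpha -> 0 < e ->
  \forall N \near admissible_infty a alpha,
    tail_prob Z a N * (expR (N * rate_fun a nu) * Num.sqrt N) <=
    prefactor a nu + e.
Proof.
move=> alpha3 e0; rewrite /admissible_infty near_withinE.
set C := prefactor a nu.
have c0 : 0 < a / nu - 1 by rewrite subr_gt0 ltr_pdivlMr// mul1r.
have l0 : 0 < ln (1 + e / C) by rewrite ln_gt0// ltrDl divr_gt0.
(* Without the half the limit would be exactly C + e; halving makes it strictly smaller, so that the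
   bound holds eventually. *)
pose dlt := ln (1 + e / C) / 2 / (a / nu - 1).
have d0 : 0 < dlt by rewrite !divr_gt0.
have Cd : C * expR (dlt * (a / nu - 1)) < C + e.
  rewrite /dlt divfK ?lt0r_neq0//.
  apply: (@lt_le_trans _ _ (C * expR (ln (1 + e / C)))).
    by rewrite ltr_pM2l// ltr_expR; lra.
  have -> : expR (ln (1 + e / C)) = 1 + e / C.
    by rewrite lnK// posrE addr_gt0// divr_gt0.
  by rewrite mulrDr mulr1 [C * (_ / _)]mulrC divfK// lt0r_neq0.
have /cvgr_lt /(_ _ Cd) ub := @cvg_tail_ub R a nu alpha dlt K nu_gt0 a_gt_nu alpha3 d0 K_gt0.
near=> N => adm; have N0 : 0 < N by case: adm.
apply: (@le_trans _ _ _ _ _ (tail_prob_ub adm d0 _ _)).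
- by rewrite ler_pdivrMr// mulrC -ler_pdivrMr//; near: N; exact: nbhs_pinfty_ge.
- rewrite -ltrBrDl -mulrBr -ltr_pdivrMr ?subr_gt0//.
  by near: N; apply: nbhs_pinfty_gt; exact: num_real.
- by apply/ltW; near: N; exact: ub.
Unshelve. all: by end_near. Qed.

Lemma near_tail_prob_lb e : 2 < alpha -> 0 < e ->
  \forall N \near admissible_infty a alpha,
    prefactor a nu - e <=
    tail_prob Z a N * (expR (N * rate_fun a nu) * Num.sqrt N).
Proof.
move=> alpha2 e0; rewrite /admissible_infty near_withinE.
set C := prefactor a nu.
have c0 : 0 < a / nu - 1 by rewrite subr_gt0 ltr_pdivlMr// mul1r.
(* Two losses, each at most [h] relative to [C]: the shift costs e^(- h) >= 1 - h, and the
   truncation costs (nu / a)^J < h. *)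
pose h := e / C / 2.
have h0 : 0 < h by do 2 apply: divr_gt0 => //.
pose dlt := h / (a / nu - 1).
have d0 : 0 < dlt by rewrite divr_gt0.
have r0 : 0 <= nu / a by rewrite divr_ge0// ltW.
have r1 : nu / a < 1 by rewrite ltr_pdivrMr// mul1r.
have [J rJ] : exists J, (nu / a) ^+ J < h.
  have q1 : `|nu / a| < 1 by rewrite ger0_norm.
  have /cvgr_lt /(_ _ h0) [J _ hJ] := cvg_expr q1.
  by exists J; exact: (hJ J (leqnn J)).
have Cd : C - e < C * (expR (dlt * (1 - a / nu)) * (1 - (nu / a) ^+ J)).
  have -> : dlt * (1 - a / nu) = - h.
    by rewrite -opprB mulrN /dlt divfK// lt0r_neq0.
  have -> : C - e = C * (1 - h - h).
    by rewrite /h; field; rewrite lt0r_neq0.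
  rewrite ltr_pM2l//.
  have := expR_ge1Dx (- h); have : expR (- h) <= 1 by rewrite expR_le1 oppr_le0 ltW.
  have := exprn_ge0 J r0; move: rJ; move: ((nu / a) ^+ J) (expR (- h)) => x y; nra.
have /cvgr_gt /(_ _ Cd) lb :=
  @cvg_tail_lb R a nu alpha dlt K J nu_gt0 a_gt_nu alpha2 d0 K_gt0.
near=> N => adm; have N0 : 0 < N by case: adm.
apply: (@le_trans _ _ _ _ _ _ (tail_prob_lb J adm d0 _ _)).
- by apply/ltW; near: N; exact: lb.
- by rewrite ler_pdivrMr// mulrC -ler_pdivrMr//; near: N; exact: nbhs_pinfty_ge.
- by rewrite -ltr_pdivrMr//; near: N; apply: nbhs_pinfty_gt; exact: num_real.
Unshelve. all: by end_near. Qed.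

End TailBounds.

Theorem proposition2p1 (R : realType) (d : measure_display)
    (T : measurableType d) (P : probability T R)
    (X : nat -> {RV P >-> R}) (nu a alpha : R) (Z : R -> {RV P >-> nat})
    (X_iid : iid X)
    (X_ge0 : forall (i : nat) (w : T), 0 <= X i w)
    (nu_gt0 : 0 < nu)
    (X_mean : ('E_P[X 0%N] = nu%:E)%E)
    (X_mgf : exists U : set R, [/\ open U, U 0 &
       forall theta : R, U theta -> ('M_P (X 0%N) theta < +oo)%E])
    (a_gt_nu : nu < a)
    (alpha_gt0 : 0 < alpha)
    (Z_pois : forall N : R, admissible a alpha N ->
       mixed_poisson
         (fun w => N * sample_mean X (Num.truncn (N `^ alpha)) w) (Z N)) :
  (3 < alpha ->
     asymp_equiv (admissible_infty a alpha)
       (tail_prob Z a)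
       (fun N => expR (- (N * rate_fun a nu)) *
                 (prefactor a nu / Num.sqrt N)))
  /\
  (2 < alpha <= 3 ->
     ((prefactor a nu)%:E <=
        limf_einf
          (fun N => (tail_prob Z a N * expR (N * rate_fun a nu) *
                     Num.sqrt N)%:E)
          (admissible_infty a alpha))%E).
Proof.
have [K [u0 [K0 u00 conc]]] := sample_mean_concentration X_iid X_ge0 X_mean X_mgf.
have C0 := prefactor_gt0 nu_gt0 a_gt_nu.
have FF : Filter (admissible_infty a alpha) by exact: within_filter.
split=> [alpha3|/andP[alpha2 _]].
- apply/cvgrPdist_le => e e0.
  (* The quotient is the normalised tail divided by the prefactor, so a tolerance [e] on it is
     [e * prefactor a nu] on the normalised tail. *)
  have eC0 : 0 < e * prefactor a nu by rewrite mulr_gt0.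
  have ub := near_tail_prob_ub X_ge0 nu_gt0 a_gt_nu K0 conc Z_pois u00 alpha3 eC0.
  have lb := near_tail_prob_lb X_ge0 nu_gt0 a_gt_nu K0 conc Z_pois u00
    (lt_trans (ltr_nat R 2 3) alpha3) eC0.
  near=> N.
  have N0 : 0 < N.
    near: N; rewrite /admissible_infty near_withinE.
    by apply: nearW => M [].
  have sN : 0 < Num.sqrt N by rewrite sqrtr_gt0.
  have -> : tail_prob Z a N / (expR (- (N * rate_fun a nu)) *
      (prefactor a nu / Num.sqrt N)) =
      tail_prob Z a N * (expR (N * rate_fun a nu) * Num.sqrt N) / prefactor a nu.
    by rewrite expRN; field; rewrite !lt0r_neq0// expR_gt0.
  rewrite ler_distlC ler_pdivlMr// ler_pdivrMr//; apply/andP; split.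
    by rewrite mulrBl mul1r; near: N; exact: lb.
  by rewrite mulrDl mul1r; near: N; exact: ub.
- rewrite limf_einfE; apply/lee_addgt0Pr => e e0.
  have lb := near_tail_prob_lb X_ge0 nu_gt0 a_gt_nu K0 conc Z_pois u00 alpha2 e0.
  rewrite -leeBlDr// -EFinB.
  (* The lower limit is a supremum, over the sets of the filter, of infima; the set of [N] where the
     bound [lb] holds is the witness. *)
  apply: le_trans (ereal_sup_ubound _); last by eexists; [exact: lb|reflexivity].
  apply: le_ereal_inf_tmp => _ [N /= lbN <-].
  by rewrite lee_fin -mulrA.
Unshelve. all: by end_near. Qed.
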